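(* In the setting of the context, there exists a collection $\{U_i\}_{i\in\mathbb{N}}$ of cylinders $U_i=U_{z_i}$, $z_i\in E(\Lambda)^c$, satisfying the following properties (with $\lambda_i=\lambda_{z_i}$, $r_i=r_{z_i}$, $d_i=d_{z_i}$, $Q_i$, $G_i$, $\mathcal{I}_i$, $K_i$ as in the context): (i) $\bigcup_{i\in\mathbb{N}}U_i=E(\Lambda)^c$. (ii) $\frac{1}{6K}U_i\cap\frac{1}{6K}U_j=\emptyset$ for every $i,j\in\mathbb{N}$ with $i\ne j$. (iii) $3r_i\le d_i(U_i,E(\Lambda))\le4r_i$ for every $i\in\mathbb{N}$. (iv) $4U_i\subset E(\Lambda)^c$ and $5U_i\cap E(\Lambda)\ne\emptyset$ for every $i\in\mathbb{N}$. (v) $(12K)^{-1}r_j\le r_i\le12Kr_j$ for every $i\in\mathbb{N}$, $j\in\mathcal{I}_i$. (vi) $K^{-2/p}\lambda_j\le\lambda_i\le K^{2/p}\lambda_j$ for every $j\in\mathcal{I}_i$. Moreover, if $U_i=G_i$, then $2^{-1/p}\lambda_j\le\lambda_i\le2^{1/p}\lambda_j$. (vii) There exists a constant $c=c(n,K)$ such that $|U_i|\le c|U_j|$ for every $i\in\mathbb{N}$ and $j\in\mathcal{I}_i$. (viii) $2U_j\subset K_iU_i$ for every $i\in\mathbb{N}$, $j\in\mathcal{I}_i$. (ix) If $U_i=Q_i$, then there exists a constant $c=c([a]_\alpha,\alpha,K)$ such that $r_i^\alpha\lambda_i^q\le c\lambda_i^p$. (x) If $U_i=G_i$, then $\frac{a(z_i)}{2}\le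 a(z)\le2a(z_i)$ for every $z\in200KQ_{r_i}(z_i)$. (xi) For any $i\in\mathbb{N}$, the cardinality $|\mathcal{I}_i|$ of $\mathcal{I}_i$ is finite. Moreover, there exists a constant $c=c(n,K)$ such that $|\mathcal{I}_i|\le c$. Additionally, there exists a partition of unity $\{\omega_i\}_{i\in\mathbb{N}}$ subordinate to the Whitney decomposition $\{2U_i\}_{i\in\mathbb{N}}$ with the following properties: (xii) $0\le\omega_i\le1$, $\omega_i\in C_0^\infty(2U_i)$ for every $i\in\mathbb{N}$ and $\sum_{i\in\mathbb{N}}\omega_i=1$ on $E(\Lambda)^c$. (xiii) There exists a constant $c=c(n,K)$ such that $\|\nabla\omega_j\|_\infty\le cr_i^{-1}$ for every $i\in\mathbb{N}$ and $j\in\mathcal{I}_i$. (xiv) There exists a constant $c=c(n,K)$ such that, for every $i\in\mathbb{N}$ and $j\in\mathcal{I}_i$, $\|\partial_t\omega_j\|_\infty\le cr_i^{-2}\lambda_i^{p-2}$ if $U_i=Q_i$, and $\|\partial_t\omega_j\|_\infty\le cr_i^{-2}\lambda_i^{-2}\Lambda$ if $U_i=G_i$.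
   Context: $n\ge1$ is an integer, $2\le p<q<\infty$, $\alpha\in(0,1]$, $q\le p+\frac{2\alpha}{n+2}$. $\Omega\subset\mathbb{R}^n$ is a bounded open set, $T>0$, $\Omega_T=\Omega\times(0,T)$. The function $a:\Omega_T\to[0,\infty)$ is bounded and there is a constant $[a]_\alpha>0$ with $|a(x,t)-a(y,t)|\le[a]_\alpha|x-y|^\alpha$ and $|a(x,t)-a(x,s)|\le[a]_\alpha|t-s|^{\alpha/2}$ for all $x,y\in\Omega$, $t,s\in(0,T)$. It is extended to $\mathbb{R}^{n+1}$ by $a(z)=\min\{\tilde a(z),\|a\|_{L^\infty(\Omega_T)}\}$, $\tilde a(x,t)=\inf_{(y,s)\in\Omega_T}\{a(y,s)+[a]_\alpha(|x-y|^\alpha+|t-s|^{\alpha/2})\}$. Let $f\in L^p(\mathbb{R}^{n+1})$, $f\ge0$, with $\iint_{\mathbb{R}^{n+1}}(f^p+af^q)\,dz<\infty$, and $d=\frac{q-1+p}{2}$. The strong maximal function is $Mg(z)=\sup\frac{1}{|Q|}\iint_Q|g|\,dw$, the supremum over all cylinders $Q=B_r(y)\times(s-\sigma,s+\sigma)$, $r,\sigma>0$, with $z\in Q$. Let $\Lambda_0>1+\|a\|_{L^\infty}$ satisfy $c(n,p,q)\iint(f^p+af^q)\,dz\le\Lambda_0$, where $c(n,p,q)$ is a constant for which $\iint_{\mathbb{R}^{n+1}}(M(f^d+(af^q)^{d/p}))^{p/d}dz\le c(n,p,q)\iint_{\mathbb{R}^{n+1}}(f^p+af^q)\,dz$. Let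 $\Lambda>\Lambda_0$ and $$E(\Lambda)=\{z\in\mathbb{R}^{n+1}:M(f^d+(af^q)^{d/p})(z)\le\Lambda^{d/p}\},$$ with complement $E(\Lambda)^c$ (open), assumed nonempty. Let $$K=2^{1/2}+800[a]_\alpha\left(\frac{1}{|B_1|}\iint_{\mathbb{R}^{n+1}}(M(f^d+(af^q)^{d/p}))^{p/d}\,dz\right)^{\frac{\alpha}{n+2}}.$$ For $z=(x,t)\in E(\Lambda)^c$ let $\lambda_z>1$ be the unique number with $\lambda_z^p+a(z)\lambda_z^q=\Lambda$. Define the metric, for $z_1=(x_1,t_1)$, $z_2=(x_2,t_2)$: $d_z(z_1,z_2)=\max\{|x_1-x_2|,\sqrt{\lambda_z^{p-2}|t_1-t_2|}\}$ if $K^2\lambda_z^p\ge a(z)\lambda_z^q$, and $d_z(z_1,z_2)=\max\{|x_1-x_2|,\sqrt{\Lambda\lambda_z^{-2}|t_1-t_2|}\}$ if $K^2\lambda_z^p<a(z)\lambda_z^q$. Let $r_z$ be given by $4r_z=\inf_{w\in E(\Lambda)}d_z(z,w)$. For $\rho>0$ put $Q_\rho(z)=B_\rho(x)\times(t-\rho^2,t+\rho^2)$, $Q_\rho^{\lambda_z}(z)=B_\rho(x)\times(t-\lambda_z^{2-p}\rho^2,t+\lambda_z^{2-p}\rho^2)$, $G_\rho^{\lambda_z}(z)=B_\rho(x)\times(t-\lambda_z^2\Lambda^{-1}\rho^2,t+\lambda_z^2\Lambda^{-1}\rho^2)$. Define $U_z=Q_{r_z}^{\lambda_z}(z)$ if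 $K^2\lambda_z^p\ge a(z)\lambda_z^q$ and $U_z=G_{r_z}^{\lambda_z}(z)$ if $K^2\lambda_z^p<a(z)\lambda_z^q$. For $c>0$, $cQ_\rho(z)=Q_{c\rho}(z)$, $cQ_\rho^{\lambda_z}(z)=Q_{c\rho}^{\lambda_z}(z)$, $cG_\rho^{\lambda_z}(z)=G_{c\rho}^{\lambda_z}(z)$, and correspondingly for $cU_z$. For points $z_i$: $Q_i=Q_{r_i}^{\lambda_i}(z_i)$, $G_i=G_{r_i}^{\lambda_i}(z_i)$; ''$U_i=Q_i$'' means $K^2\lambda_i^p\ge a(z_i)\lambda_i^q$ and ''$U_i=G_i$'' means $K^2\lambda_i^p<a(z_i)\lambda_i^q$. $d_i(U_i,E(\Lambda))=\inf_{z\in U_i,w\in E(\Lambda)}d_i(z,w)$; $\mathcal{I}_i=\{j\in\mathbb{N}:2U_i\cap2U_j\ne\emptyset\}$; $K_i=50K^2$ if $U_i=Q_i$ and $K_i=50K$ if $U_i=G_i$. *)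

(* Defs.v *)
From HB Require Import structures.
From mathcomp Require Import all_boot all_order all_algebra.
From mathcomp Require Import all_classical all_reals all_analysis.

Set Implicit Arguments.
Unset Strict Implicit.
Unset Printing Implicit Defensive.

Import Order.TTheory GRing.Theory Num.Theory.
Import numFieldNormedType.Exports.

Local Open Scope classical_set_scope.
Local Open Scope ring_scope.

Definition measure_rV_display : measure_display -> measure_display.
Proof. exact. Qed.

(* The sigma-algebra is the product one, generated by the coordinates, exactly
   as the library does for [n.-tuple T]. *)
Section measurable_rV.
Context {d} {T : sigmaRingType d}.
Variable n : nat.

Let coors : 'I_n -> 'rV[T]_n -> T := fun i v => v ord0 i.

Let rV_set0 : g_sigma_preimage coors set0.
Proof. exact: sigma_algebra0. Qed.

Let rV_setC A : g_sigma_preimage coors A -> g_sigma_preimage coors (~` A).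
Proof. exact: sigma_algebraC. Qed.

Let rV_bigcup (F : (set 'rV[T]_n)^nat) :
  (forall i, g_sigma_preimage coors (F i)) ->
  g_sigma_preimage coors (\bigcup_i (F i)).
Proof. exact: sigma_algebra_bigcup. Qed.

HB.instance Definition _ := @isMeasurable.Build (measure_rV_display d)
  'rV[T]_n (g_sigma_preimage coors) rV_set0 rV_setC rV_bigcup.

End measurable_rV.

Lemma measurable_rV_coord d (T : sigmaRingType d) n (i : 'I_n) :
  measurable_fun [set: 'rV[T]_n] (fun v => v ord0 i).
Proof.
move=> _ Y mY; rewrite setTI; apply: sub_sigma_algebra => /=.
rewrite -bigcup_seq/=; exists i => /=; first by rewrite mem_index_enum.
by exists Y => //; rewrite setTI.
Qed.

Lemma measurable_fun_rV d1 d2 (T1 : measurableType d1) (T2 : measurableType d2)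
    n (f : T1 -> 'rV[T2]_n) :
  (forall i, measurable_fun [set: T1] (fun x => f x ord0 i)) ->
  measurable_fun [set: T1] f.
Proof.
move=> mf _ A mA; rewrite setTI; move: A mA.
suff : @measurable _ 'rV[T2]_n `<=` [set A | measurable (f @^-1` A)] by [].
apply: smallest_sub.
  split => /=.
  - by rewrite preimage_set0.
  - by move=> A mA; rewrite setTD preimage_setC; exact: measurableC.
  - by move=> F mF; rewrite preimage_bigcup; exact: bigcupT_measurable.
rewrite -bigcup_seq/=; apply: bigcup_sub => i _ A [B mB <-] /=.
by rewrite setTI -[X in measurable X]setTI; exact: mf.
Qed.

Section lebesgue_rV.
Variable R : realType.

Definition row_cons n (p : measurableTypeR R * 'rV[R]_n) : 'rV[R]_n.+1 :=
  \row_i oapp (p.2 ord0) p.1 (unlift ord0 i).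

Definition row_uncons n (v : 'rV[R]_n.+1) : measurableTypeR R * 'rV[R]_n :=
  (v ord0 ord0, \row_j v ord0 (lift ord0 j)).

Lemma row_consK n : cancel (@row_cons n) (@row_uncons n).
Proof.
move=> [x v]; congr pair; first by rewrite mxE unlift_none.
by apply/rowP => j; rewrite !mxE liftK.
Qed.

Lemma measurable_row_cons n : measurable_fun setT (@row_cons n).
Proof.
apply: measurable_fun_rV => i.
under eq_fun do rewrite mxE.
case: unliftP => [j _|_] /=; last exact: measurable_fst.
apply: (@measurableT_comp _ _ _ _ _ _ (fun v : 'rV[R]_n => v ord0 j)) => //.
exact: measurable_rV_coord.
Qed.

Lemma measurable_row_uncons n : measurable_fun setT (@row_uncons n).
Proof.
apply/measurable_fun_pairP; split; first exact: measurable_rV_coord.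
apply: measurable_fun_rV => i /=.
under eq_fun do rewrite mxE.
exact: measurable_rV_coord.
Qed.

Section step.
Variables (n : nat) (mu : {sigma_finite_measure set 'rV[R]_n -> \bar R}).

Definition lebesgue_rVS : set 'rV[R]_n.+1 -> \bar R :=
  pushforward (lebesgue_measure \x mu)%E (@row_cons n).

Let m0 : lebesgue_rVS set0 = 0%E.
Proof. by rewrite /lebesgue_rVS /pushforward preimage_set0 measure0. Qed.

Let m_ge0 A : (0 <= lebesgue_rVS A)%E.
Proof. by rewrite /lebesgue_rVS /pushforward measure_ge0. Qed.

Let m_sigma_additive : semi_sigma_additive lebesgue_rVS.
Proof.
have mpre A : measurable A -> measurable (@row_cons n @^-1` A).
  by move=> mA; rewrite -[X in measurable X]setTI; exact: measurable_row_cons.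
move=> F mF tF mUF; rewrite /lebesgue_rVS /pushforward preimage_bigcup.
apply: measure_semi_sigma_additive => [k||]; [exact: mpre| |].
- apply/trivIsetP => /= i j _ _ ij; rewrite -preimage_setI.
  by move/trivIsetP : tF => /(_ _ _ _ _ ij) ->//; rewrite preimage_set0.
- by rewrite -preimage_bigcup; exact: mpre.
Qed.

HB.instance Definition _ := isMeasure.Build _ _ _ lebesgue_rVS
  m0 m_ge0 m_sigma_additive.

Let m_sigma_finite : sigma_finite setT lebesgue_rVS.
Proof.
have /sigma_finiteP[F [FT ndF Foo]] := sigma_finiteT (@lebesgue_measure R).
have /sigma_finiteP[G [GT ndG Goo]] := sigma_finiteT mu.
have FGT : setT = \bigcup_k (F k `*` G k).
  rewrite -setXTT FT GT predeqE => -[x y]; split.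
    move=> [/= [n0 _ Fnx] [k _ Gky]]; exists (maxn n0 k) => //; split.
    - by move: x Fnx; exact/subsetPset/ndF/leq_maxl.
    - by move: y Gky; exact/subsetPset/ndG/leq_maxr.
  by move=> [n0 _ []/= ? ?]; split; exists n0.
exists (fun k => @row_uncons n @^-1` (F k `*` G k)).
  by rewrite -preimage_bigcup -FGT preimage_setT.
move=> k; have [mFk Fk] := Foo k; have [mGk Gk] := Goo k; split.
  rewrite -[X in measurable X]setTI; apply: measurable_row_uncons => //.
  exact: measurableX.
rewrite /lebesgue_rVS /pushforward -comp_preimage.
rewrite (_ : row_uncons (n := n) \o _ = id); last first.
  by apply/funext => x; exact: row_consK.
by rewrite preimage_id product_measure1E// lte_mul_pinfty// ge0_fin_numE.
Qed.

HB.instance Definition _ := @Measure_isSigmaFinite.Build _ _ _ lebesgue_rVS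
  m_sigma_finite.

End step.

Fixpoint lebesgue_rV n : {sigma_finite_measure set 'rV[R]_n -> \bar R} :=
  match n with
  | 0 => \d_(0 : 'rV[R]_0)
  | m.+1 => @lebesgue_rVS m (lebesgue_rV m)
  end.

End lebesgue_rV.

Notation spacetime R n := ('rV[R]_n * R)%type.

Section spacetime_notions.
Context {R : realType} {n : nat}.
Implicit Types (x y : 'rV[R]_n) (z w : spacetime R n).

(* [measurableTypeR R] is [R] with the structure carried by
   [lebesgue_measure]. *)
Definition lebesgue_st :
    {measure set ('rV[R]_n * measurableTypeR R)%type -> \bar R} :=
  (@lebesgue_rV R n \x @lebesgue_measure R)%E.

(* The library's norm on ['rV_n] is the sup norm (with the same topology and
   bounded sets). *)
Definition enorm x : R := Num.sqrt (\sum_i x ord0 i ^+ 2).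

Definition eball x (r : R) : set 'rV[R]_n := [set y | enorm (y - x) < r].

Definition unit_ball_volume : R := fine (@lebesgue_rV R n (eball 0 1)).

Definition cylinder z (r sigma : R) : set (spacetime R n) :=
  eball z.1 r `*` [set` `]z.2 - sigma, z.2 + sigma[].

Definition strong_maximal (g : spacetime R n -> R) z : \bar R :=
  ereal_sup [set ((fine (lebesgue_st Q))^-1%:E *
                  \int[lebesgue_st]_(w in Q) `|g w|%:E)%E |
    Q in [set Q | exists w r sigma,
                  [/\ 0 < r, 0 < sigma, Q = cylinder w r sigma & Q z]]].

Definition space_time_cylinder (Omega : set 'rV[R]_n) (T : R) :
  set (spacetime R n) := Omega `*` [set` `]0, T[].

Definition Linfty_norm (D : set (spacetime R n)) (a : spacetime R n -> R) : R :=
  fine ('N[lebesgue_st]_+oo[EFin \o (a \_ D)])%E.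

Definition holder_extension (Omega : set 'rV[R]_n) (T alpha A : R)
    (a : spacetime R n -> R) z : R :=
  let D := space_time_cylinder Omega T in
  Num.min
    (inf [set a w + A * (enorm (z.1 - w.1) `^ alpha
                         + `|z.2 - w.2| `^ (alpha / 2)) | w in D])
    (Linfty_norm D a).

Definition partial_t (g : spacetime R n -> R) z : R := 'D_(0, 1) g z.

Definition gradient_x (g : spacetime R n -> R) z : 'rV[R]_n :=
  \row_i 'D_(delta_mx 0 i, 0) g z.

(* C^oo, as existence and continuity of all iterated directional
   derivatives. *)
Definition smooth (g : spacetime R n -> R) : Prop :=
  forall s : seq (spacetime R n),
    let h := foldr (fun v k => 'D_v k) g s in
    continuous h /\ forall v z, derivable h z v.

Definition test_function (D : set (spacetime R n)) (g : spacetime R n -> R) :=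
  let supp := closure [set z | g z != 0] in
  [/\ smooth g, compact supp & supp `<=` D].

End spacetime_notions.

Section intrinsic.
Context {R : realType} {n : nat}.
(* [b] is the extended coefficient. *)
Variables (p q Lam K : R) (b : spacetime R n -> R) (E : set (spacetime R n)).
Implicit Types (z w : spacetime R n) (rho c : R).

(* The number [l > 1] with [l^p + b(z) l^q = Lam]; [get] returns a default
   value if there is none, which cannot happen when [1 + b(z) < Lam]. *)
Definition lambda z : R :=
  get [set l : R | 1 < l /\ l `^ p + b z * l `^ q = Lam].

Definition p_phase z : bool :=
  b z * lambda z `^ q <= K ^+ 2 * lambda z `^ p.

Definition intrinsic_dist z w1 w2 : R :=
  Num.max (enorm (w1.1 - w2.1))
    (Num.sqrt ((if p_phase z then lambda z `^ (p - 2) else Lam * lambda z ^- 2)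
               * `|w1.2 - w2.2|)).

Definition intrinsic_set_dist z (A B : set (spacetime R n)) : R :=
  inf [set intrinsic_dist z w1 w2 | w1 in A & w2 in B].

Definition whitney_radius z : R := inf [set intrinsic_dist z z w | w in E] / 4.

Definition Qstd rho z := cylinder z rho (rho ^+ 2).

Definition Qlambda rho z := cylinder z rho (lambda z `^ (2 - p) * rho ^+ 2).

Definition Glambda rho z := cylinder z rho (lambda z ^+ 2 * Lam^-1 * rho ^+ 2).

(* [c U_z]; in particular [U_z] is [Ucyl 1 z]. *)
Definition Ucyl c z : set (spacetime R n) :=
  if p_phase z then Qlambda (c * whitney_radius z) z
  else Glambda (c * whitney_radius z) z.

Definition neighbours (Z : nat -> spacetime R n) (i : nat) : set nat :=
  [set j | Ucyl 2 (Z i) `&` Ucyl 2 (Z j) !=set0].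

Definition Kfactor z : R := if p_phase z then 50 * K ^+ 2 else 50 * K.

End intrinsic.

(* Main.v *)
(** On the set where the maximal function is large, every cylinder has measure
    at most (maximal energy) / Lambda.  Applied to [4 U_z], and combined with the
    gap condition on [q - p], this makes [A (4 r_z)^alpha lambda_z^q] a small
    multiple of [lambda_z^p] in both phases, so that the coefficient is almost
    constant at the scale of [U_z] and [lambda] varies by a bounded factor
    between intersecting cylinders.  The intrinsic metrics are parabolic metrics
    [max (|x|, sqrt (sigma_z |t|))]; comparability of [lambda] gives
    [sigma_z <= 4 K^2 sigma_w] for neighbours, after which the covering is a
    maximal disjoint family of the cylinders [(6 K)^-1 U_z].  The partition of
    unity is [psi_i * prod_(j < i) (1 - psi_j)] for bumps [psi_i] equal to [1] on
    [U_i]: it telescopes, so nothing is divided by a sum of bumps. *)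

Require Import Defs.
From mathcomp Require Import all_boot all_order all_algebra finmap.
From mathcomp Require Import all_classical all_reals all_analysis.
From mathcomp Require Import measurable_realfun ess_sup_inf ring lra.

Set Implicit Arguments.
Unset Strict Implicit.
Unset Printing Implicit Defensive.

Import Order.TTheory GRing.Theory Num.Theory.
Import numFieldNormedType.Exports.

Local Open Scope classical_set_scope.
Local Open Scope ring_scope.

(** * Lebesgue measure on row vectors *)

(** The number [kappa], equal to A times the power alpha / (n + 2) of me / |B_1|, need not be small;
    it is small compared with [K], and [K] is the threshold between the phases. In the G phase b
    lambda^q exceeds K^2 lambda^p, so a change of this term by a multiple of kappa lambda^p is
    harmless; in the other phase such a change is absorbed by the factor K^2 allowed for lambda^p.
    The geometric obstacle is that every point carries its own metric. Passing from the metric at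
    [z] to that at [w] and back at a cost of 2 K each way would be too much for cores of size (6
    K)^-1 and for enlargements linear in [K]. The metrics differ only in the time weight, so one of
    the two directions is free. As every point off [E] is itself the center of a cylinder and
    intersecting cylinders have comparable radii, no selection of cylinders by size is made. *)

Section affine_invariance.
Context {R : realType}.
Local Notation mu := (@lebesgue_measure R).

Let affine (a b : R) : measurableTypeR R -> measurableTypeR R :=
  fun x => a * x + b.

Let measurable_affine a b : measurable_fun setT (affine a b).
Proof. by apply: measurable_funD => //; exact: measurable_funM. Qed.

(** Uniqueness of Lebesgue measure: the pushforward under the affine map, scaled by [a], gives
    half-open intervals their length. *)
Lemma lebesgue_measure_affine (a b : R) (A : set (measurableTypeR R)) : 0 < a ->
  measurable A ->
  mu A = (a%:E * mu ((fun x : R => (a * x + b)%R) @^-1` A))%E.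
Proof.
move=> a0 mA.
pose m' := mscale (NngNum (ltW a0)) (pushforward mu (affine a b)).
have -> : (a%:E * mu ((fun x : R => (a * x + b)%R) @^-1` A))%E = m' (measurable_affine a b) A by [].
apply: lebesgue_measure_unique => // _ [[c d] _ <-] /=.
rewrite /m' /mscale /= /pushforward.
have -> : affine a b @^-1` `]c, d] = `](c - b) / a, (d - b) / a]%classic.
  apply/seteqP; split => x /=; rewrite !in_itv/= /affine.
    by rewrite ltr_pdivrMr// ler_pdivlMr// mulrC ltrBlDr lerBrDr.
  by rewrite ltr_pdivrMr// ler_pdivlMr// mulrC ltrBlDr lerBrDr.
rewrite !lebesgue_measure_itv/= !lte_fin.
rewrite ltr_pM2r ?invr_gt0// ltrD2r.
case: ifPn => // _; rewrite ?mule0//.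
rewrite !EFinN -!EFinB -EFinM; congr EFin.
by field; rewrite gt_eqF.
Qed.

Let scale n (a : R) (y : 'rV[R]_n) : 'rV[R]_n -> 'rV[R]_n :=
  fun v => a *: v + y.

Let measurable_scale n a y : measurable_fun setT (@scale n a y).
Proof.
apply: measurable_fun_rV => i; rewrite /scale.
under eq_fun do rewrite !mxE.
apply: measurable_funD => //; apply: measurable_funM => //.
exact: measurable_rV_coord.
Qed.

(** Induction on the dimension: the map splits into the first coordinate and the rest, and a product
    measure is determined by its values on rectangles. *)
Lemma lebesgue_rV_affine n (a : R) (y : 'rV[R]_n) (A : set 'rV[R]_n) : 0 < a ->
  measurable A ->
  lebesgue_rV R n A =
    ((a ^+ n)%:E * lebesgue_rV R n ((fun v => (a *: v + y)%R) @^-1` A))%E.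
Proof.
move=> a0; elim: n y A => [|n IH] y A mA.
  rewrite expr0 mul1e; congr (lebesgue_rV R 0 _); apply/seteqP.
  have e (u v : 'rV[R]_0) : u = v by rewrite (thinmx0 u) (thinmx0 v).
  by split=> v /=; rewrite (e (_ + _) v).
rewrite /= /lebesgue_rVS /pushforward.
pose y1 : R := y ord0 ord0; pose y2 : 'rV[R]_n := \row_j y ord0 (lift ord0 j).
pose S (u : measurableTypeR R * 'rV[R]_n) : measurableTypeR R * 'rV[R]_n :=
  (affine a y1 u.1, scale a y2 u.2).
have mS : measurable_fun setT S.
  apply/measurable_fun_pairP; split.
    exact: (measurableT_comp (measurable_affine _ _)).
  exact: (measurableT_comp (measurable_scale _ _)).
have mB : measurable (@row_cons R n @^-1` A).
  by rewrite -[X in measurable X]setTI; exact: measurable_row_cons.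
have -> : @row_cons R n @^-1` ((fun v => a *: v + y) @^-1` A) =
    S @^-1` (@row_cons R n @^-1` A).
  suff e : (fun v => a *: v + y) \o @row_cons R n = @row_cons R n \o S.
    exact: (congr1 (fun T => T @^-1` A) e).
  apply/funext => -[u v] /=; apply/rowP => i; rewrite !mxE/=.
  case: unliftP => [j ->|->] /=; last by [].
  by rewrite !mxE.
move: (_ @^-1` A) mB => B mB.
have an0 : 0 <= a ^+ n.+1 by rewrite exprn_ge0// ltW.
pose m' := mscale (NngNum an0) (pushforward (mu \x lebesgue_rV R n)%E S).
have -> : ((a ^+ n.+1)%:E * (mu \x lebesgue_rV R n)%E (S @^-1` B))%E = m' mS B by [].
apply: product_measure_unique => // {B mB A mA} A B mA mB.
transitivity ((a ^+ n.+1)%:E * (mu \x lebesgue_rV R n)%E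
    ((affine a y1 @^-1` A) `*` (scale a y2 @^-1` B)))%E; first by [].
rewrite product_measure1E; last 2 first.
- by rewrite -[X in measurable X]setTI; exact: measurable_affine.
- by rewrite -[X in measurable X]setTI; exact: measurable_scale.
apply: etrans; last first.
  exact/esym/(congr2 mule (lebesgue_measure_affine y1 a0 mA) (IH y2 B mB)).
by rewrite exprS EFinM muleACA.
Qed.

End affine_invariance.

(** * Euclidean norm: Cauchy-Schwarz and the triangle inequality *)

Section euclidean_norm.
Context {R : realType} {n : nat}.
Implicit Types x y : 'rV[R]_n.

Let sqs x := \sum_i x ord0 i ^+ 2.

Let sqs_ge0 x : 0 <= sqs x.
Proof. by apply: sumr_ge0 => i _; exact: sqr_ge0. Qed.

Lemma enorm_ge0 x : 0 <= enorm x.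
Proof. exact: sqrtr_ge0. Qed.

Lemma sqr_enorm x : enorm x ^+ 2 = \sum_i x ord0 i ^+ 2.
Proof. exact: sqr_sqrtr (sqs_ge0 x). Qed.

Lemma enormN x : enorm (- x) = enorm x.
Proof.
by rewrite /enorm; congr Num.sqrt; apply: eq_bigr => i _; rewrite mxE sqrrN.
Qed.

Lemma enorm0 : enorm (0 : 'rV[R]_n) = 0.
Proof.
by rewrite /enorm big1 ?sqrtr0// => i _; rewrite mxE expr0n.
Qed.

Lemma enormZ (a : R) x : enorm (a *: x) = `|a| * enorm x.
Proof.
rewrite /enorm (eq_bigr (fun i => a ^+ 2 * x ord0 i ^+ 2)).
  by rewrite -mulr_sumr sqrtrM ?sqr_ge0// sqrtr_sqr.
by move=> i _; rewrite mxE exprMn.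
Qed.

Lemma ler_coord_enorm x i : `|x ord0 i| <= enorm x.
Proof.
rewrite -sqrtr_sqr; apply: ler_wsqrtr; rewrite (bigD1 i)//= lerDl.
by apply: sumr_ge0 => j _; exact: sqr_ge0.
Qed.

(** The sharp factor is the square root of [n]; [n] dominates it because [n <= n ^ 2] for natural
    numbers. *)
Lemma enorm_le x (c : R) : 0 <= c -> (forall i, `|x ord0 i| <= c) ->
  enorm x <= n%:R * c.
Proof.
move=> c0 xc; have nc0 : 0 <= n%:R * c by rewrite mulr_ge0.
rewrite -(@ler_pXn2r _ 2)// ?nnegrE ?enorm_ge0// sqr_enorm.
apply: (@le_trans _ _ (\sum_(i < n) c ^+ 2)).
  apply: ler_sum => i _; rewrite -real_normK ?num_real//.
  by rewrite lerXn2r ?nnegrE ?normr_ge0// xc.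
rewrite sumr_const card_ord exprMn -[leLHS]mulr_natl ler_wpM2r ?sqr_ge0//.
by rewrite -natrX ler_nat; case: (n) => // m; rewrite leq_pmulr.
Qed.

(** Young's inequality in each coordinate, with the weight [c] that makes both resulting sums equal
    to the product of the norms. *)
Let dot_le x y : \sum_i x ord0 i * y ord0 i <= enorm x * enorm y.
Proof.
have [x0|x0] := eqVneq (enorm x) 0.
  rewrite x0 mul0r big1// => i _; have := ler_coord_enorm x i.
  by rewrite x0 normr_le0 => /eqP ->; rewrite mul0r.
have [y0|y0] := eqVneq (enorm y) 0.
  rewrite y0 mulr0 big1// => i _; have := ler_coord_enorm y i.
  by rewrite y0 normr_le0 => /eqP ->; rewrite mulr0.
have xp : 0 < enorm x by rewrite lt_neqAle eq_sym x0 enorm_ge0.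
have yp : 0 < enorm y by rewrite lt_neqAle eq_sym y0 enorm_ge0.
pose c := enorm y / enorm x.
have c0 : 0 < c by rewrite divr_gt0.
apply: (@le_trans _ _ (2^-1 * (c * enorm x ^+ 2 + c^-1 * enorm y ^+ 2))).
  rewrite !sqr_enorm !mulr_sumr -big_split mulr_sumr/=.
  apply: ler_sum => i _; move: (x _ _) (y _ _) => u v.
  rewrite -subr_ge0.
  have -> : 2^-1 * (c * u ^+ 2 + c^-1 * v ^+ 2) - u * v =
    2^-1 * c * (u - c^-1 * v) ^+ 2 by field; rewrite gt_eqF.
  by rewrite mulr_ge0 ?sqr_ge0// mulr_ge0// ltW.
have -> // : 2^-1 * (c * enorm x ^+ 2 + c^-1 * enorm y ^+ 2) = enorm x * enorm y.
by rewrite /c; field; rewrite x0 y0.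
Qed.

Lemma ler_enormD x y : enorm (x + y) <= enorm x + enorm y.
Proof.
rewrite -(@ler_pXn2r _ 2)// ?nnegrE ?addr_ge0 ?enorm_ge0//.
rewrite sqrrD !sqr_enorm.
rewrite (eq_bigr (fun i => x ord0 i ^+ 2 + y ord0 i ^+ 2 +
    (x ord0 i * y ord0 i) *+ 2)); last first.
  by move=> i _; rewrite mxE; ring.
rewrite big_split big_split/= sumrMnl addrAC lerD2r lerD2l.
by rewrite lerMn2r dot_le orbT.
Qed.

Lemma enormBC x y : enorm (x - y) = enorm (y - x).
Proof. by rewrite -enormN opprB. Qed.

Lemma enorm_triangle x y w : enorm (x - w) <= enorm (x - y) + enorm (y - w).
Proof. by rewrite (le_trans _ (ler_enormD _ _))// addrA subrK. Qed.

End euclidean_norm.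

(** * Volumes of Euclidean balls and of cylinders *)

Section volumes.
Context {R : realType}.

(** Balls of the sup norm have an explicit volume; squeezing the Euclidean unit ball between two of
    them shows that its volume is finite and positive. *)
Let box n (c : R) : set 'rV[R]_n := [set v | forall i, `|v ord0 i| < c].

Let measurable_box n c : measurable (@box n c).
Proof.
have -> : @box n c = \bigcap_(i in [set: 'I_n])
    ((fun v : 'rV[R]_n => v ord0 i) @^-1` `](- c), c[%classic).
  apply/seteqP; split => v /=.
    by move=> h i _ /=; rewrite in_itv/= -ltr_norml.
  by move=> h i; move: (h i I); rewrite /= in_itv/= -ltr_norml.
apply: fin_bigcap_measurable => // i _; rewrite -[X in measurable X]setTI.
exact: measurable_rV_coord.
Qed.

Lemma measurable_enorm n : measurable_fun setT (@enorm R n).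
Proof.
apply: (@measurableT_comp _ _ _ _ _ _ (@Num.sqrt R)) => //.
  exact: continuous_measurable_fun (@sqrt_continuous R).
apply: measurable_sum => i; apply: measurable_funX.
exact: measurable_rV_coord.
Qed.

Lemma measurable_eball n (x : 'rV[R]_n) r : measurable (eball x r).
Proof.
have -> : eball x r = (fun y => enorm (y - x)) @^-1` `]-oo, r[%classic.
  by apply/seteqP; split => y /=; rewrite in_itv.
rewrite -[X in measurable X]setTI.
apply: (@measurableT_comp _ _ _ _ _ _ (@enorm R n)) => //.
  exact: measurable_enorm.
apply: measurable_fun_rV => i; under eq_fun do rewrite !mxE.
by apply: measurable_funB => //; exact: measurable_rV_coord.
Qed.

Let box_volume n c : 0 < c -> lebesgue_rV R n (@box n c) = ((2 * c) ^+ n)%:E.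
Proof.
move=> c0; elim: n => [|n IH] /=.
  by rewrite /= diracE mem_set// => -[].
rewrite /lebesgue_rVS /pushforward.
have -> : @row_cons R n @^-1` @box n.+1 c = `](- c), c[%classic `*` @box n c.
  apply/seteqP; split => -[u v] /=.
    move=> h; split.
      by have := h ord0; rewrite /row_cons mxE unlift_none/= in_itv/= ltr_norml.
    by move=> i; have := h (lift ord0 i); rewrite /row_cons mxE liftK.
  move=> [uc h] i; rewrite mxE; case: unliftP => [j _|_] /=; first exact: h.
  by move: uc; rewrite in_itv/= ltr_norml.
rewrite product_measure1E//; last exact: measurable_box.
have := congr2 mule (lebesgue_measure_itv `](- c), c[) IH => /= ->.
by rewrite lte_fin gtrN// -EFinB -EFinM exprS opprK -mulr2n mulr_natl.
Qed.

Lemma unit_ball_volume_fin n :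
  lebesgue_rV R n (eball 0 1) = (unit_ball_volume (R := R) (n := n))%:E.
Proof.
rewrite /unit_ball_volume fineK// ge0_fin_numE ?measure_ge0//.
apply: (@le_lt_trans _ _ (lebesgue_rV R n (@box n 1))).
  apply: le_measure; rewrite ?inE; [exact: measurable_eball|exact: measurable_box|].
  move=> v /= v1 i; apply: le_lt_trans v1; rewrite subr0.
  exact: ler_coord_enorm.
by rewrite box_volume// ltry.
Qed.

Lemma unit_ball_volume_gt0 n : 0 < unit_ball_volume (R := R) (n := n).
Proof.
rewrite -lte_fin -unit_ball_volume_fin.
(* The denominator [n.+1] gives [n%:R * c < 1], so that the box lies in the open unit ball. *)
pose c : R := n.+1%:R^-1.
have c0 : 0 < c by rewrite invr_gt0.
apply: (@lt_le_trans _ _ (lebesgue_rV R n (@box n c))).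
  by rewrite box_volume// lte_fin exprn_gt0// mulr_gt0.
apply: le_measure; rewrite ?inE; [exact: measurable_box|exact: measurable_eball|].
move=> v /= vc; rewrite /eball/= subr0.
apply: (@le_lt_trans _ _ (n%:R * c)).
  by apply: enorm_le => [|i]; [exact: ltW|exact/ltW/vc].
by rewrite ltr_pdivrMr// mul1r ltr_nat.
Qed.

Lemma eball_volume n (x : 'rV[R]_n) r : 0 < r ->
  lebesgue_rV R n (eball x r) = (r ^+ n * unit_ball_volume (R := R) (n := n))%:E.
Proof.
move=> r0; rewrite (lebesgue_rV_affine x r0); last exact: measurable_eball.
rewrite EFinM -unit_ball_volume_fin; congr (_ * lebesgue_rV R n _)%E.
apply/seteqP; split => v; rewrite /eball/= addrK subr0 enormZ gtr0_norm//.
  by rewrite gtr_pMr.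
by rewrite gtr_pMr.
Qed.

Lemma measurable_cylinder n (z : spacetime R n) r s :
  measurable (cylinder z r s : set ('rV[R]_n * measurableTypeR R)).
Proof. by apply: measurableX => //; exact: measurable_eball. Qed.

Lemma cylinder_volume n (z : spacetime R n) r s : 0 < r -> 0 < s ->
  lebesgue_st (cylinder z r s) =
    (unit_ball_volume (R := R) (n := n) * r ^+ n * (2 * s))%:E.
Proof.
move=> r0 s0; rewrite /lebesgue_st/= /cylinder product_measure1E//; last first.
  exact: measurable_eball.
have := congr2 mule (eball_volume z.1 r0)
  (lebesgue_measure_itv `]z.2 - s, z.2 + s[) => /= ->.
rewrite lte_fin (_ : z.2 - s < z.2 + s) -?EFinB -?EFinM; last by lra.
by congr EFin; ring.
Qed.

End volumes.

(** * Smooth functions *)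

Section flat_function.
Context {R : realType}.

(** Supplies the derivative of [flat k] at the origin, where no single formula is valid on a
    neighbourhood. *)
Lemma is_derive_quadratic (f : R -> R) (C : R) :
  (forall x, `|f x| <= C * x ^+ 2) -> is_derive (0 : R) (1 : R) f 0.
Proof.
move=> fC; have f0 : f 0 = 0.
  by apply/normr0_eq0/eqP; rewrite eq_le normr_ge0 (le_trans (fC 0))// expr0n mulr0.
have C0 : 0 <= C by have := le_trans (normr_ge0 _) (fC 1); rewrite expr1n mulr1.
have lim0 : h^-1 *: ((f \o shift 0) (h *: (1 : R)) - f 0) @[h --> 0^'] --> (0 : R).
  apply/cvgrPdist_le => e e0; near=> h.
  have h0 : h != 0 by near: h; exact: nbhs_dnbhs_neq.
  rewrite sub0r normrN f0 subr0 /= addr0 normrM normfV ler_pdivrMl ?normr_gt0//.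
  rewrite [_ *: _]mulr1 (le_trans (fC h))// -real_normK ?num_real// expr2 mulrA mulrC.
  rewrite ler_pM2l ?normr_gt0//.
  (* [C + 1] instead of [C], which may be 0. *)
  have : `|h| <= e / (C + 1).
    near: h; apply: dnbhs0_le; rewrite divr_gt0// ltr_wpDl//.
  rewrite ler_pdivlMr ?ltr_wpDl// => /(le_trans _); apply.
  by rewrite mulrDr mulr1 mulrC lerDl.
by split; [apply/cvg_ex; exists 0|exact: cvg_lim lim0].
Unshelve. all: by end_near. Qed.

(* The family [flat k] is stable under differentiation up to linear
   combinations; [flat 0] is the usual flat function [exp (- 1 / x)]. *)
Definition flat (k : nat) (x : R) : R :=
  if 0 < x then x^-1 ^+ k * expR (- x^-1) else 0.

Lemma flat_ge0 k x : 0 <= flat k x.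
Proof.
rewrite /flat; case: ifPn => // x0.
by rewrite mulr_ge0 ?expR_ge0// exprn_ge0// invr_ge0 ltW.
Qed.

(** With y = 1 / x this is y^k exp(-y) <= k!: the exponential dominates the term y^k / k! of its
    series. *)
Lemma flat_le k x : flat k x <= k`!%:R.
Proof.
rewrite /flat; case: ifPn => // x0.
have y0 : 0 < x^-1 by rewrite invr_gt0.
rewrite expRN ler_pdivrMr ?expR_gt0//.
case: k => [|k]; first by rewrite expr0 mul1r -expR0 ler_expR ltW.
rewrite mulrC -ler_pdivrMr; last by rewrite ltr0n fact_gt0.
by apply: le_trans (expR_ge1Dxn k (ltW y0)); rewrite lerDr.
Qed.

(** Trades two indices for a factor [x ^+ 2]; since [flat k.+2] is bounded, [flat k] is
    quadratically small at the origin. *)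
Lemma flat_quadratic k x : flat k x = flat k.+2 x * x ^+ 2.
Proof.
rewrite /flat; case: ifPn => [x0|]; rewrite ?mul0r//.
by rewrite !exprS; field; rewrite gt_eqF.
Qed.

Lemma is_derive_flat k (x : R) :
  is_derive x 1 (flat k) (flat k.+2 x - k%:R * flat k.+1 x).
Proof.
have [x0|x0|->] := ltrgtP x 0.
- rewrite /flat ltNge (ltW x0)/= mulr0 subr0.
  apply: (near_eq_is_derive (f := cst 0)) => //.
  by near=> y; rewrite /flat ltNge; have -> : y <= 0 by near: y; exact: (cvgr_le x).
- pose g (y : R) := y^-1 ^+ k * expR (- y^-1).
  have xn : x != 0 by rewrite gt_eqF.
  have dg : is_derive x 1 g (flat k.+2 x - k%:R * flat k.+1 x).
    have dV : is_derive x 1 (fun y : R => y^-1) (- (x ^- 2)).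
      have := is_deriveV xn (is_derive_id x (1 : R)).
      by rewrite [_ *: _]mulr1.
    have dX := is_deriveX k dV.
    have dE : is_derive x 1 (fun y : R => expR (- y^-1))
        (expR (- x^-1) * (- - (x ^- 2))).
      apply: (@is_derive1_comp _ expR (fun y : R => - y^-1)).
    have := is_deriveM dX dE. rewrite exprfctE => dg.
    apply: is_derive_eq; rewrite /flat x0 /GRing.scale/=.
    by case: k {g dX dg} => [|k]; rewrite ?expr0/= ?exprS; field.
  apply: (near_eq_is_derive (f := g)) => //.
  by near=> y; rewrite /flat /g; have -> : 0 < y by near: y; exact: (cvgr_gt x).
- rewrite [flat _.+2 0]/flat [flat _.+1 0]/flat ltxx mulr0 subr0.
  apply: (@is_derive_quadratic _ k.+2`!%:R) => y.
  rewrite flat_quadratic normrM (ger0_norm (sqr_ge0 _)) ger0_norm ?flat_ge0//.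
  by rewrite ler_wpM2r ?sqr_ge0// flat_le.
Unshelve. all: by end_near. Qed.
End flat_function.

Section smooth_class.
Context {R : realType} {V : normedModType R}.
Implicit Types (f g : V -> R) (z v : V).

Lemma is_derive_chain (h : R -> R) g z v (a : R) : differentiable g z ->
  is_derive (g z) 1 h a -> is_derive z v (h \o g) (a * 'D_v g z).
Proof.
move=> dg [dh ha].
have dh' : differentiable h (g z) by exact/derivable1_diffP.
have dhg : differentiable (h \o g) z by exact: differentiable_comp.
apply: DeriveDef; first exact: diff_derivable.
rewrite deriveE// diff_comp//= -(deriveE _ dg) (diff1E dh')/= derive1E ha.
exact: mulrC.
Qed.

(* Closed under every ['D_v], which is what makes its members smooth; [c] is the
   constant differential of an affine [f]. *)
Inductive smooth_expr : (V -> R) -> Prop :=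
| smooth_affine f (c : V -> R) of (forall z, differentiable f z) &
    (forall v z, 'D_v f z = c v) : smooth_expr f
| smooth_add f g of smooth_expr f & smooth_expr g : smooth_expr (f \+ g)
| smooth_mul f g of smooth_expr f & smooth_expr g : smooth_expr (f \* g)
| smooth_inv f of smooth_expr f & (forall z, f z != 0) :
    smooth_expr (fun z => (f z)^-1)
| smooth_flat k f of smooth_expr f : smooth_expr (flat k \o f).

Lemma smooth_cst (c : R) : smooth_expr (fun=> c).
Proof.
apply: (@smooth_affine _ (fun=> 0)) => [z|v z]; first exact: differentiable_cst.
exact: derive_cst.
Qed.

Lemma smooth_opp f : smooth_expr f -> smooth_expr (\- f).
Proof.
move=> sf; have -> : \- f = (fun=> -1) \* f.
  by apply/funext => z /=; rewrite mulN1r.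
by apply: smooth_mul => //; exact: smooth_cst.
Qed.

(** Full differentiability, stronger than the existence of directional derivatives, is what
    composition with [flat k] requires; it also yields continuity. *)
Lemma smooth_expr_differentiable f z : smooth_expr f -> differentiable f z.
Proof.
move=> sf; elim: sf z => {f} //.
- by move=> f g _ df _ dg z; exact: differentiableD.
- by move=> f g _ df _ dg z; exact: differentiableM.
- by move=> f _ df f0 z; exact: differentiableV.
- move=> k f _ df z; apply: differentiable_comp => //.
  by apply/derivable1_diffP; case: (is_derive_flat k (f z)).
Qed.

Lemma smooth_expr_derivable f z v : smooth_expr f -> derivable f z v.
Proof. by move=> /smooth_expr_differentiable sf; exact: diff_derivable. Qed.

Lemma smooth_expr_continuous f : smooth_expr f -> continuous f.
Proof. by move=> sf z; apply/differentiable_continuous/smooth_expr_differentiable. Qed.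

Lemma smooth_expr_derive f v : smooth_expr f -> smooth_expr ('D_v f).
Proof.
move=> sf; elim: sf => {f}.
- move=> f c df fc; have -> : 'D_v f = fun=> c v by exact/funext.
  exact: smooth_cst.
- move=> f g sf IHf sg IHg; have -> : 'D_v (f \+ g) = 'D_v f \+ 'D_v g.
    by apply/funext => z; apply: deriveD; exact: smooth_expr_derivable.
  exact: smooth_add.
- move=> f g sf IHf sg IHg.
  have -> : 'D_v (f \* g) = (f \* 'D_v g) \+ (g \* 'D_v f).
    by apply/funext => z; apply: deriveM; exact: smooth_expr_derivable.
  by apply: smooth_add; exact: smooth_mul.
- move=> f sf IH f0.
  have -> : 'D_v (fun z => (f z)^-1) =
      \- ((fun z => (f z)^-1) \* (fun z => (f z)^-1) \* 'D_v f).
    apply/funext => z; rewrite deriveV//; last exact: smooth_expr_derivable.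
    by rewrite [LHS]mulNr/= -expr2 exprVn.
  by apply: smooth_opp; apply: smooth_mul => //; apply: smooth_mul; exact: smooth_inv.
- move=> k f sf IH.
  have -> : 'D_v (flat k \o f) =
      ((flat k.+2 \o f) \+ ((fun=> - k%:R) \* (flat k.+1 \o f))) \* 'D_v f.
    apply/funext => z.
    have [_ ->] := is_derive_chain v (smooth_expr_differentiable z sf)
      (is_derive_flat k (f z)).
    by rewrite /= mulNr.
  apply: smooth_mul => //; apply: smooth_add; first exact: smooth_flat.
  by apply: smooth_mul; [exact: smooth_cst|exact: smooth_flat].
Qed.

End smooth_class.

Lemma smooth_expr_smooth {R : realType} {n} (g : spacetime R n -> R) :
  smooth_expr g -> smooth g.
Proof.
move=> sg s; suff sh : smooth_expr (foldr (fun v k => 'D_v k) g s).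
  by split=> [|v z]; [exact: smooth_expr_continuous|exact: smooth_expr_derivable].
by elim: s => //= v s; exact: smooth_expr_derive.
Qed.

(** * A smooth cutoff of one variable with an explicit bound on its slope *)

Section cutoff.
Context {R : realType}.

Let flat_half : R := flat 0 2^-1.

Let half_gt0 : 0 < flat_half.
Proof. by rewrite /flat_half /flat invr_gt0 ltr0n/= mul1r expR_gt0. Qed.

Lemma flat0_mono : {homo @flat R 0 : x y / x <= y}.
Proof.
move=> x y xy; rewrite {1}/flat; case: ifPn => x0; last exact: flat_ge0.
have y0 := lt_le_trans x0 xy.
by rewrite /flat y0 !mul1r ler_expR lerN2 lef_pV2.
Qed.

Lemma flat_le0 k (x : R) : x <= 0 -> flat k x = 0.
Proof. by rewrite /flat leNgt => /negbTE ->. Qed.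

Let den (s : R) := flat 0 (2 - s) + flat 0 (s - 1).

(** The arguments 2 - s and s - 1 add up to 1, so one of them is at least 1 / 2. *)
Let half_den s : flat_half <= den s.
Proof.
have [s1|s1] := leP s (3 / 2).
  by apply: ler_wpDr; [exact: flat_ge0|apply: flat0_mono; lra].
by apply: ler_wpDl; [exact: flat_ge0|apply: flat0_mono; lra].
Qed.

Let den_gt0 s : 0 < den s.
Proof. exact: lt_le_trans half_gt0 (half_den s). Qed.

Definition cutoff (s : R) := flat 0 (2 - s) * (flat 0 (2 - s) + flat 0 (s - 1))^-1.

Lemma cutoff_ge0 s : 0 <= cutoff s.
Proof. by rewrite mulr_ge0 ?flat_ge0// invr_ge0 ltW// den_gt0. Qed.

Lemma cutoff_le1 s : cutoff s <= 1.
Proof. by rewrite ler_pdivrMr ?den_gt0// mul1r lerDl flat_ge0. Qed.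

Lemma cutoff1 s : s <= 1 -> cutoff s = 1.
Proof.
move=> s1; have := den_gt0 s; rewrite /cutoff /den (@flat_le0 0 (s - 1)) ?subr_le0//.
by rewrite addr0 => s0; rewrite divff// gt_eqF.
Qed.

Lemma cutoff0 s : 2 <= s -> cutoff s = 0.
Proof. by move=> s2; rewrite /cutoff flat_le0 ?mul0r// subr_le0. Qed.

Lemma smooth_cutoff (V : normedModType R) (f : V -> R) :
  smooth_expr f -> smooth_expr (cutoff \o f).
Proof.
move=> sf.
have s1 : smooth_expr (flat 0 \o (fun z => 2 - f z)).
  by apply/smooth_flat/smooth_add; [exact: smooth_cst|exact: smooth_opp].
have s2 : smooth_expr (flat 0 \o (fun z => f z - 1)).
  by apply/smooth_flat/smooth_add => //; exact: smooth_cst.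
apply: (smooth_mul s1); apply: smooth_inv (smooth_add s1 s2) _ => z.
by rewrite gt_eqF//; exact: den_gt0.
Qed.

(** Obtained from [flat 2 <= 2], [flat 0 <= 1] and the lower bound [flat_half] for the denominator;
    the 4 bounds a difference of two values of [flat 2]. *)
Definition cutoff_slope : R := 2 / flat_half + 4 / flat_half ^+ 2.

Lemma cutoff_slope_ge0 : 0 <= cutoff_slope.
Proof. by rewrite addr_ge0// divr_ge0// ?exprn_ge0 ?ltW. Qed.

(** Quotient rule; the derivative of [flat 0] is [flat 2], as the other term of [is_derive_flat] has
    coefficient 0. *)
Let dcutoff s := - flat 2 (2 - s) / den s -
  flat 0 (2 - s) * (flat 2 (s - 1) - flat 2 (2 - s)) / den s ^+ 2.

Let is_derive_cutoff (s : R) : is_derive s 1 cutoff (dcutoff s).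
Proof.
have d1 : is_derive s 1 (fun s : R => flat 0 (2 - s)) (- flat 2 (2 - s)).
  have := @is_derive1_comp _ (flat 0) (fun s : R => 2 - s) s _ _
    (is_derive_flat 0 (2 - s)) (is_deriveB (is_derive_cst (2 : R) s (1 : R)) (is_derive_id s (1 : R))).
  by move=> d; apply: is_derive_eq; rewrite sub0r mul0r subr0 mulrN1.
have d2 : is_derive s 1 (fun s : R => flat 0 (s - 1)) (flat 2 (s - 1)).
  have := @is_derive1_comp _ (flat 0) (fun s : R => s - 1) s _ _
    (is_derive_flat 0 (s - 1)) (is_deriveB (is_derive_id s (1 : R)) (is_derive_cst (1 : R) s (1 : R))).
  by move=> d; apply: is_derive_eq; rewrite subr0 mul0r subr0 mulr1.
have dn0 : den s != 0 by rewrite gt_eqF.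
have d3 := is_deriveV dn0 (is_deriveD d1 d2).
have d := is_deriveM d1 d3; apply: is_derive_eq; rewrite /dcutoff /GRing.scale/=.
rewrite -/(den s); move: dn0; rewrite /den => dn0; field; rewrite dn0 //.
Qed.

Let dcutoff_le s : `|dcutoff s| <= cutoff_slope.
Proof.
have n2 x : `|flat 2 x| <= 2 :> R by rewrite ger0_norm ?flat_ge0// (flat_le 2).
have n0 x : `|flat 0 x| <= 1 :> R by rewrite ger0_norm ?flat_ge0// (flat_le 0).
have Vd : (den s)^-1 <= flat_half^-1 by rewrite lef_pV2 ?posrE.
have Vd0 : 0 <= (den s)^-1 by rewrite invr_ge0 ltW.
rewrite (le_trans (ler_normB _ _))// lerD//.
  by rewrite normrM normrN (ger0_norm Vd0) ler_pM.
rewrite !normrM -exprVn normrX (ger0_norm Vd0) -exprVn ler_pM ?mulr_ge0 ?exprn_ge0//.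
- by rewrite -[leRHS]mul1r ler_pM// (le_trans (ler_normB _ _))// (le_trans (lerD (n2 _) (n2 _)))//; lra.
- by rewrite lerXn2r ?nnegrE ?(le_trans Vd0).
Qed.

Let dcutoff0 s : 2 <= s -> dcutoff s = 0.
Proof.
by move=> s2; rewrite /dcutoff !(@flat_le0 _ (2 - s)) ?subr_le0// oppr0 !mul0r subr0.
Qed.

Lemma derive_cutoff_comp (V : normedModType R) (f : V -> R) z v :
  differentiable f z -> exists a, [/\ 'D_v (cutoff \o f) z = a * 'D_v f z,
    `|a| <= cutoff_slope & 2 <= f z -> a = 0].
Proof.
move=> df; exists (dcutoff (f z)); split; last 2 first.
- exact: dcutoff_le.
- exact: dcutoff0.
by have [_ ->] := is_derive_chain v df (is_derive_cutoff (f z)).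
Qed.

End cutoff.

(** * Telescoping partition of unity *)

Section telescoping_partition.
Context {R : realType} {V : normedModType R}.
Variable psi : nat -> V -> R.
Hypothesis spsi : forall i, smooth_expr (psi i).
Hypothesis psi_ge0 : forall i z, 0 <= psi i z.
Hypothesis psi_le1 : forall i z, psi i z <= 1.

(* [1 - unpicked N] is the sum of the first [N] functions [picked i]. *)
Definition unpicked N (z : V) : R := \prod_(j < N) (1 - psi j z).

Definition picked i (z : V) : R := psi i z * unpicked i z.

Let unpickedS N : unpicked N.+1 = unpicked N \* (fun z => 1 - psi N z).
Proof. by apply/funext => z; rewrite /unpicked big_ord_recr. Qed.

Let smooth_1B i : smooth_expr (fun z => 1 - psi i z).
Proof. by apply: smooth_add; [exact: smooth_cst|exact: smooth_opp]. Qed.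

Let smooth_unpicked N : smooth_expr (unpicked N).
Proof.
elim: N => [|N IH]; last by rewrite unpickedS; exact: smooth_mul.
have -> : unpicked 0 = fun=> 1 by apply/funext => z; rewrite /unpicked big_ord0.
exact: smooth_cst.
Qed.

Lemma smooth_picked i : smooth_expr (picked i).
Proof. exact: smooth_mul. Qed.

Let unpicked_ge0 N z : 0 <= unpicked N z.
Proof. by apply: prodr_ge0 => i _; rewrite subr_ge0. Qed.

Let unpicked_le1 N z : unpicked N z <= 1.
Proof.
elim: N => [|N IH]; first by rewrite /unpicked big_ord0.
by rewrite unpickedS mulr_ile1 ?subr_ge0// gerBl.
Qed.

Lemma picked_ge0 i z : 0 <= picked i z.
Proof. exact: mulr_ge0. Qed.

Lemma picked_le1 i z : picked i z <= 1.
Proof. by rewrite mulr_ile1. Qed.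

Let sum_picked N z : \sum_(0 <= i < N) picked i z = 1 - unpicked N z.
Proof.
elim: N => [|N IH]; first by rewrite big_nil /unpicked big_ord0 subrr.
by rewrite big_nat_recr//= IH unpickedS /picked /=; ring.
Qed.

(** From index [i.+1] on the product contains the factor 0, so the partial sums are eventually
    constant. *)
Lemma series_picked z : (exists i, psi i z = 1) ->
  series (fun i => picked i z) @ \oo --> (1 : R).
Proof.
move=> [i pi1]; apply: cvg_near_cst; exists i.+1 => // N /= iN.
rewrite /series/= sum_picked /unpicked (bigD1 (Ordinal iN))//= pi1 subrr.
by rewrite mul0r subr0.
Qed.

Let derive_unpicked N v z :
  `|'D_v (unpicked N) z| <= \sum_(j < N) `|'D_v (psi j) z|.
Proof.
elim: N => [|N IH].
  have -> : unpicked 0 = cst 1 by apply/funext => y; rewrite /unpicked big_ord0.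
  by rewrite derive_cst normr0 big_ord0.
rewrite big_ord_recr/= unpickedS.
rewrite deriveM; [|exact: smooth_expr_derivable..].
rewrite addrC (le_trans (ler_normD _ _))// lerD//.
  have -> : 'D_v (fun z => 1 - psi N z) z = - 'D_v (psi N) z.
    have -> := deriveB (@derivable_cst _ _ _ (1 : R) z v)
      (smooth_expr_derivable (z := z) (v := v) (spsi N)).
    by rewrite derive_cst sub0r.
  by rewrite normrM normrN ler_piMl// ger0_norm.
apply: le_trans IH; rewrite normrM ler_piMl// ger0_norm ?subr_ge0//.
by rewrite gerBl.
Qed.

(** The factor [psi i z] is kept in front of the sum: it restricts the estimate to points where only
    the bumps of neighbours of [i] vary. *)
Lemma derive_picked i v z : `|'D_v (picked i) z| <=
  `|'D_v (psi i) z| + psi i z * \sum_(j < i) `|'D_v (psi j) z|.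
Proof.
rewrite deriveM; [|exact: smooth_expr_derivable..].
rewrite addrC (le_trans (ler_normD _ _))// lerD// normrM ger0_norm//.
  by rewrite ler_piMl.
by rewrite ler_wpM2l// derive_unpicked.
Qed.

End telescoping_partition.

Lemma sqr_lt_bound {R : realType} (u c : R) : 0 <= c -> u ^+ 2 <= 2 -> 2 < c ^+ 2 -> `|u| < c.
Proof.
move=> c0 u2 c2; rewrite -(@ltr_pXn2r _ 2)// real_normK ?num_real//.
exact: le_lt_trans c2.
Qed.

(** * Space-time bumps adapted to a cylinder *)

Section bump.
Context {R : realType} {n : nat}.
Implicit Types z w v : spacetime R n.

Let smooth_coord (i : 'I_n) : smooth_expr (fun z => z.1 ord0 i).
Proof.
apply: (@smooth_affine _ _ _ (fun z => z.1 ord0 i)) => [z|v z].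
  apply: (@differentiable_comp _ _ _ _ fst (fun x : 'rV[R]_n => x ord0 i)).
    apply: linear_differentiable => y; exact: cvg_fst.
  exact: differentiable_coord.
apply: cvg_lim => //; apply: cvg_near_cst; near=> h.
have h0 : h != 0 by near: h; exact: nbhs_dnbhs_neq.
by rewrite /= !mxE addrK [LHS]mulKf.
Unshelve. all: by end_near. Qed.

Let smooth_time : smooth_expr (fun z => z.2).
Proof.
apply: (@smooth_affine _ _ _ snd) => [z|v z].
  apply: linear_differentiable => y; exact: cvg_snd.
apply: cvg_lim => //; apply: cvg_near_cst; near=> h.
have h0 : h != 0 by near: h; exact: nbhs_dnbhs_neq.
by rewrite /= addrK [LHS]mulKf.
Unshelve. all: by end_near. Qed.

Section quadratic_forms.
Variables (z0 : spacetime R n) (r sigma : R).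

Definition bump_x z : R := \sum_i (r^-1 * (z.1 ord0 i - z0.1 ord0 i)) ^+ 2.

(* Squared, so that the cutoff is composed with a polynomial. *)
Definition bump_t z : R := (sigma / r ^+ 2 * (z.2 - z0.2)) ^+ 2.

Definition bump z : R := cutoff (bump_x z) * cutoff (bump_t z).

Let smooth_shift i :
  smooth_expr (fun z : spacetime R n => r^-1 * (z.1 ord0 i - z0.1 ord0 i)).
Proof.
by apply: smooth_mul; [|apply: smooth_add => //]; exact: smooth_cst.
Qed.

Lemma smooth_bump_x : smooth_expr bump_x.
Proof.
rewrite /bump_x; elim: (index_enum _) => [|i s IH].
  by under eq_fun do rewrite big_nil; exact: smooth_cst.
under eq_fun do rewrite big_cons.
by apply: smooth_add => //; exact: smooth_mul.
Qed.

Let smooth_shift_t :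
  smooth_expr (fun z : spacetime R n => sigma / r ^+ 2 * (z.2 - z0.2)).
Proof.
by apply: smooth_mul; [|apply: smooth_add => //]; exact: smooth_cst.
Qed.

Lemma smooth_bump_t : smooth_expr bump_t.
Proof. exact: smooth_mul. Qed.

Lemma smooth_bump : smooth_expr bump.
Proof.
apply: smooth_mul; apply: smooth_cutoff; first exact: smooth_bump_x.
exact: smooth_bump_t.
Qed.

Lemma bump_ge0 z : 0 <= bump z.
Proof. by rewrite mulr_ge0// cutoff_ge0. Qed.

Lemma bump_le1 z : bump z <= 1.
Proof. by rewrite mulr_ile1// ?cutoff_ge0// cutoff_le1. Qed.

Lemma bump_xE z : bump_x z = (enorm (z.1 - z0.1) / r) ^+ 2.
Proof.
rewrite exprMn sqr_enorm mulr_suml; apply: eq_bigr => i _.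
by rewrite !mxE exprMn mulrC.
Qed.

Hypotheses (r_gt0 : 0 < r) (sigma_gt0 : 0 < sigma).

Lemma bump1 z : enorm (z.1 - z0.1) < r -> sigma * `|z.2 - z0.2| < r ^+ 2 ->
  bump z = 1.
Proof.
move=> zx zt; have r20 : 0 < r ^+ 2 by rewrite exprn_gt0.
have x1 : bump_x z <= 1.
  rewrite bump_xE expr_le1 ?divr_ge0 ?enorm_ge0 ?(ltW r_gt0)//.
  by rewrite ler_pdivrMr// mul1r ltW.
have t1 : bump_t z <= 1.
  rewrite /bump_t -real_normK ?num_real// expr_le1// !normrM gtr0_norm//.
  rewrite gtr0_norm ?invr_gt0// mulrAC ler_pdivrMr// mul1r.
  exact: ltW.
by rewrite /bump !cutoff1// mulr1.
Qed.

(** The square root of 2 is below 2, so the closed region where the cutoffs can be nonzero lies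
    strictly inside the open doubled cylinder; this room lets the closed support fit into it. *)
Lemma bump_core z : bump_x z <= 2 -> bump_t z <= 2 ->
  enorm (z.1 - z0.1) < 2 * r /\ sigma * `|z.2 - z0.2| < 2 * r ^+ 2.
Proof.
have r20 : 0 < r ^+ 2 by rewrite exprn_gt0.
rewrite bump_xE => /(@sqr_lt_bound R _ 2) zx /(@sqr_lt_bound R _ 2) zt; split.
  have := zx ltac:(lra) ltac:(lra).
  by rewrite ger0_norm ?divr_ge0 ?enorm_ge0 ?(ltW r_gt0)// ltr_pdivrMr.
have := zt ltac:(lra) ltac:(lra).
by rewrite !normrM gtr0_norm// gtr0_norm ?invr_gt0// mulrAC ltr_pdivrMr.
Qed.

Lemma derive_bump v z :
  `|'D_v bump z| <= cutoff_slope * (`|'D_v bump_x z| + `|'D_v bump_t z|) /\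
  ('D_v bump z != 0 -> bump_x z <= 2 /\ bump_t z <= 2).
Proof.
have dx := smooth_expr_differentiable z smooth_bump_x.
have dt := smooth_expr_differentiable z smooth_bump_t.
have [a [ea ca a0]] := derive_cutoff_comp v dx.
have [b [eb cb b0]] := derive_cutoff_comp v dt.
have -> : 'D_v bump z = cutoff (bump_x z) * (b * 'D_v bump_t z) +
    cutoff (bump_t z) * (a * 'D_v bump_x z).
  rewrite -ea -eb; apply: deriveM; apply: smooth_expr_derivable;
  apply: smooth_cutoff; [exact: smooth_bump_x|exact: smooth_bump_t].
split.
  rewrite mulrDr addrC (le_trans (ler_normD _ _))// lerD//.
    rewrite normrM ger0_norm ?cutoff_ge0//.
    rewrite (le_trans (ler_piMl _ (cutoff_le1 _)))// normrM.
    by rewrite ler_wpM2r.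
  rewrite normrM ger0_norm ?cutoff_ge0//.
  rewrite (le_trans (ler_piMl _ (cutoff_le1 _)))// normrM.
  by rewrite ler_wpM2r.
move=> ne0; split; rewrite leNgt; apply: contra ne0 => /ltW h.
  by rewrite (cutoff0 h) (a0 h) !mul0r mulr0 addr0.
by rewrite (cutoff0 h) (b0 h) !mul0r mulr0 addr0.
Qed.

End quadratic_forms.
End bump.

(** A quadratic polynomial is known exactly along a line, so its derivative is the coefficient of
    [h] and no sum has to be differentiated. *)
Lemma derive_quadratic_line {R : realType} {V : normedModType R} (f : V -> R) z v
    (a b : R) :
  (forall h : R, f (h *: v + z) = f z + h * a + h ^+ 2 * b) -> 'D_v f z = a.
Proof.
move=> fh; apply: cvg_lim => //.
apply: (@cvg_trans _ ((fun h : R => a + h * b) @ 0^')).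
  apply: near_eq_cvg; near=> h.
  have h0 : h != 0 by near: h; exact: nbhs_dnbhs_neq.
  by rewrite /= fh /GRing.scale/=; field.
have -> : nbhs a = nbhs (a + 0 * b) by rewrite mul0r addr0.
apply: (@cvg_within_filter _ _ _ (nbhs (0 : R))).
by apply: cvgD; [exact: cvg_cst|apply: cvgMl; exact: cvg_id].
Unshelve. all: by end_near. Qed.

Section bump_derivatives.
Context {R : realType} {n : nat}.
Variables (z0 : spacetime R n) (r sigma : R).
Hypotheses (r_gt0 : 0 < r) (sigma_gt0 : 0 < sigma).
Implicit Types z : spacetime R n.

Let derive_bump_x k z : 'D_(delta_mx 0 k, 0) (bump_x z0 r) z =
  2 * r^-1 * (r^-1 * (z.1 ord0 k - z0.1 ord0 k)).
Proof.
apply: (@derive_quadratic_line _ _ _ _ _ _ (r^-1 ^+ 2)) => h.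
rewrite /bump_x (bigD1 k)//= [in RHS](bigD1 k)//= !mxE !eqxx mulr1.
rewrite (eq_bigr (fun i => (r^-1 * (z.1 ord0 i - z0.1 ord0 i)) ^+ 2)).
  by ring.
by move=> i ik; rewrite !mxE (negbTE ik) mulr0 add0r.
Qed.

Let derive_bump_t_x k z : 'D_(delta_mx 0 k, 0) (bump_t z0 r sigma) z = 0.
Proof.
apply: (@derive_quadratic_line _ _ _ _ _ _ 0) => h.
by rewrite /bump_t /= scaler0 add0r !mulr0 !addr0.
Qed.

Let derive_bump_x_t z : 'D_(0, 1) (bump_x z0 r) z = 0.
Proof.
apply: (@derive_quadratic_line _ _ _ _ _ _ 0) => h.
rewrite mulr0 mulr0 !addr0 /bump_x; apply: eq_bigr => i _.
by rewrite /= scaler0 add0r.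
Qed.

Let derive_bump_t z : 'D_(0, 1) (bump_t z0 r sigma) z =
  2 * (sigma / r ^+ 2) * (sigma / r ^+ 2 * (z.2 - z0.2)).
Proof.
apply: (@derive_quadratic_line _ _ _ _ _ _ ((sigma / r ^+ 2) ^+ 2)) => h.
by rewrite /bump_t /= [h *: 1]mulr1; ring.
Qed.

Lemma derive_bump_space k z :
  `|'D_(delta_mx 0 k, 0) (bump z0 r sigma) z| <= 4 * cutoff_slope * r^-1.
Proof.
have [->|ne0] := eqVneq ('D_(delta_mx 0 k, 0) (bump z0 r sigma) z) 0.
  by rewrite normr0 !mulr_ge0 ?cutoff_slope_ge0 ?invr_ge0// ltW.
have [le sup] := derive_bump z0 r sigma (delta_mx 0 k, 0) z.
have [x2 t2] := sup ne0; apply: (le_trans le).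
rewrite derive_bump_t_x normr0 addr0 derive_bump_x.
have -> : 4 * cutoff_slope * r^-1 = cutoff_slope * (4 * r^-1) :> R by ring.
rewrite ler_wpM2l ?cutoff_slope_ge0//.
have [zx _] := bump_core r_gt0 sigma_gt0 x2 t2.
have zk : `|z.1 ord0 k - z0.1 ord0 k| <= 2 * r.
  have := ler_coord_enorm (z.1 - z0.1) k; rewrite !mxE => /le_trans; apply.
  exact: ltW.
rewrite !normrM (gtr0_norm (_ : 0 < r^-1)) ?invr_gt0// gtr0_norm//.
(* One factor 2 comes from differentiating the square, the other from the radius of the support. *)
have -> : 4 * r^-1 = 2 * r^-1 * (r^-1 * (2 * r)) by field; rewrite gt_eqF.
by rewrite !ler_wpM2l// ?mulr_ge0// invr_ge0 ltW.
Qed.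

Lemma derive_bump_time z :
  `|'D_(0, 1) (bump z0 r sigma) z| <= 4 * cutoff_slope * (sigma / r ^+ 2).
Proof.
have s0 : 0 <= sigma / r ^+ 2 by rewrite divr_ge0 ?exprn_ge0// ltW.
have [->|ne0] := eqVneq ('D_(0, 1) (bump z0 r sigma) z) 0.
  by rewrite normr0 mulr_ge0// mulr_ge0// cutoff_slope_ge0.
have [le sup] := derive_bump z0 r sigma (0, 1) z.
have [x2 t2] := sup ne0; apply: (le_trans le).
rewrite derive_bump_x_t normr0 add0r derive_bump_t.
have -> : 4 * cutoff_slope * (sigma / r ^+ 2) =
  cutoff_slope * (4 * (sigma / r ^+ 2)) :> R by ring.
rewrite ler_wpM2l ?cutoff_slope_ge0//.
have [_ zt] := bump_core r_gt0 sigma_gt0 x2 t2.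
have {}zt : `|sigma / r ^+ 2 * (z.2 - z0.2)| <= 2.
  rewrite normrM (ger0_norm s0) mulrAC ler_pdivrMr ?exprn_gt0//.
  exact: ltW.
rewrite normrM [X in X * _]ger0_norm; last by rewrite mulr_ge0.
have -> : 4 * (sigma / r ^+ 2) = 2 * (sigma / r ^+ 2) * 2 by ring.
by rewrite ler_wpM2l// mulr_ge0.
Qed.

(** Derivatives are included because the estimates for the partition count the bumps that vary at a
    given point. *)
Lemma bump_supportP z : bump z0 r sigma z != 0 \/ (exists v, 'D_v (bump z0 r sigma) z != 0) ->
  enorm (z.1 - z0.1) < 2 * r /\ sigma * `|z.2 - z0.2| < 2 * r ^+ 2.
Proof.
move=> h; suff [] : bump_x z0 r z <= 2 /\ bump_t z0 r sigma z <= 2.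
  exact: bump_core.
case: h => [|[v h]]; last by have [_] := derive_bump z0 r sigma v z; exact.
rewrite /bump mulf_eq0 negb_or => /andP[x0 t0]; split.
  by rewrite leNgt; apply: contra x0 => /ltW/cutoff0 ->.
by rewrite leNgt; apply: contra t0 => /ltW/cutoff0 ->.
Qed.

(** The closed set where both quadratic forms are at most 2 contains the support and lies in a
    product of segments, which gives compactness. *)
Lemma bump_test_function (g : spacetime R n -> R) (D : set (spacetime R n)) :
  smooth_expr g -> (forall z, g z != 0 -> bump z0 r sigma z != 0) ->
  (forall z, enorm (z.1 - z0.1) < 2 * r -> sigma * `|z.2 - z0.2| < 2 * r ^+ 2 ->
    D z) ->
  test_function D g.
Proof.
move=> sg gb coreD.
pose C := bump_x z0 r @^-1` [set u | u <= 2] `&`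
  bump_t z0 r sigma @^-1` [set u | u <= 2].
have closedC : closed C.
  apply: closedI; apply: preimage_closed => //; try exact: closed_le.
    by move=> z _; exact: (smooth_expr_continuous (smooth_bump_x _ _)).
  by move=> z _; exact: (smooth_expr_continuous (smooth_bump_t _ _ _)).
have suppC : closure [set z | g z != 0] `<=` C.
  rewrite closureE; apply: smallest_sub => // z /= /gb.
  rewrite /bump mulf_eq0 negb_or => /andP[x2 t2]; split => /=.
    by rewrite leNgt; apply: contra x2 => /ltW/cutoff0 ->.
  by rewrite leNgt; apply: contra t2 => /ltW/cutoff0 ->.
split; first exact: smooth_expr_smooth.
- pose B := [set x : 'rV[R]_n | forall i,
      `[z0.1 ord0 i - 2 * r, z0.1 ord0 i + 2 * r]%classic (x ord0 i)] `*`
    `[z0.2 - 2 * r ^+ 2 / sigma, z0.2 + 2 * r ^+ 2 / sigma]%classic.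
  have cB : compact B.
    apply: compact_setX; last exact: segment_compact.
    apply: (@rV_compact R n (fun i =>
      `[z0.1 ord0 i - 2 * r, z0.1 ord0 i + 2 * r]%classic)) => i.
    exact: segment_compact.
  apply: (subclosed_compact (@closed_closure _ _) cB) => z /suppC[x2 t2].
  have [zx zt] := bump_core r_gt0 sigma_gt0 x2 t2.
  split => /=.
    move=> i; have := ler_coord_enorm (z.1 - z0.1) i; rewrite !mxE => zi.
    by rewrite in_itv/= -ler_distlC distrC (le_trans zi)// ltW.
  rewrite in_itv/= -ler_distlC distrC ler_pdivlMr// mulrC.
  exact: ltW.
- by move=> z /suppC[x2 t2]; have [] := bump_core r_gt0 sigma_gt0 x2 t2; exact: coreD.
Qed.

End bump_derivatives.

(** * Intrinsic parabolic balls and the covering *)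

Section parabolic_distance.
Context {R : realType} {n : nat}.
Implicit Types (z w u : spacetime R n) (s c : R).

(** Common form of the two phases of [intrinsic_dist], with the time weight as a parameter. *)
Definition para_dist s z w : R :=
  Num.max (enorm (z.1 - w.1)) (Num.sqrt (s * `|z.2 - w.2|)).

Lemma para_dist_ge0 s z w : 0 <= para_dist s z w.
Proof. by rewrite le_max enorm_ge0. Qed.

Lemma para_distC s z w : para_dist s z w = para_dist s w z.
Proof. by rewrite /para_dist enormBC distrC. Qed.

Lemma para_distxx s z : para_dist s z z = 0.
Proof. by rewrite /para_dist !subrr enorm0 normr0 mulr0 sqrtr0 maxxx. Qed.

Lemma para_dist_triangle s z w u : 0 <= s ->
  para_dist s z u <= para_dist s z w + para_dist s w u.
Proof.
move=> s0; rewrite ge_max; apply/andP; split.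
  apply: le_trans (enorm_triangle _ w.1 _) _.
  by apply: lerD; rewrite le_max lexx.
apply: (@le_trans _ _ (Num.sqrt (s * `|z.2 - w.2|) + Num.sqrt (s * `|w.2 - u.2|))).
  rewrite -(@ler_pXn2r _ 2)// ?nnegrE ?addr_ge0 ?sqrtr_ge0//.
  rewrite sqr_sqrtr ?mulr_ge0// sqrrD !sqr_sqrtr ?mulr_ge0// -addrA addrCA.
  apply: ler_wpDl; first by rewrite mulrn_wge0// mulr_ge0 ?sqrtr_ge0.
  by rewrite -mulrDr ler_wpM2l// ler_distD.
by apply: lerD; rewrite le_max lexx orbT.
Qed.

Lemma para_dist_lt s c z w : 0 <= s -> 0 < c ->
  (para_dist s z w < c) = (enorm (z.1 - w.1) < c) && (s * `|z.2 - w.2| < c ^+ 2).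
Proof.
move=> s0 c0; rewrite gt_max; congr (_ && _).
rewrite -(@ltr_pXn2r _ 2)// ?nnegrE ?sqrtr_ge0 ?(ltW c0)//.
by rewrite sqr_sqrtr// mulr_ge0.
Qed.

(** [1 <= c] takes care of the space part, which the time weight does not rescale. *)
Lemma para_dist_scale s s' c z w : 0 <= s -> 1 <= c -> s' <= c ^+ 2 * s ->
  para_dist s' z w <= c * para_dist s z w.
Proof.
move=> s0 c1 ss'; have c0 : 0 <= c by lra.
rewrite ge_max; apply/andP; split.
  apply: (@le_trans _ _ (1 * para_dist s z w)); first by rewrite mul1r le_max lexx.
  by rewrite ler_wpM2r// para_dist_ge0.
apply: (@le_trans _ _ (c * Num.sqrt (s * `|z.2 - w.2|))); last first.
  by rewrite ler_wpM2l// le_max lexx orbT.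
have -> : c * Num.sqrt (s * `|z.2 - w.2|) = Num.sqrt (c ^+ 2 * (s * `|z.2 - w.2|)).
  by rewrite [RHS]sqrtrM ?sqr_ge0// sqrtr_sqr (ger0_norm c0).
by apply: ler_wsqrtr; rewrite mulrA ler_wpM2r.
Qed.

Lemma cylinder_para_dist s c z w : 0 < s -> 0 < c ->
  cylinder z c (s^-1 * c ^+ 2) w = (para_dist s z w < c) :> Prop.
Proof.
move=> s0 c0; rewrite para_dist_lt ?ltW//; apply/propext; split.
  move=> [wx wt]; rewrite enormBC distrC; apply/andP; split; first exact: wx.
  move: wt; rewrite /= in_itv/= -ltr_distl ltr_pdivlMl//.
move=> /andP[wx wt]; split; first by rewrite /eball/= enormBC.
by rewrite /= in_itv/= -ltr_distl ltr_pdivlMl// distrC.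
Qed.

Lemma para_ball_volume s c z : 0 < s -> 0 < c ->
  lebesgue_st [set w | para_dist s z w < c] =
  (2 * unit_ball_volume (R := R) (n := n) * (c ^+ n.+2 / s))%:E.
Proof.
move=> s0 c0.
have -> : [set w | para_dist s z w < c] = cylinder z c (s^-1 * c ^+ 2).
  by apply/funext => w; rewrite cylinder_para_dist.
rewrite cylinder_volume ?mulr_gt0 ?invr_gt0 ?exprn_gt0//; congr EFin.
by rewrite !exprS expr0; ring.
Qed.

Lemma measurable_para_ball s c z : 0 < s -> 0 < c ->
  measurable ([set w | para_dist s z w < c] : set ('rV[R]_n * measurableTypeR R)).
Proof.
move=> s0 c0.
have -> : [set w | para_dist s z w < c] = cylinder z c (s^-1 * c ^+ 2).
  by apply/funext => w; rewrite cylinder_para_dist.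
exact: measurable_cylinder.
Qed.

End parabolic_distance.

(** * Whitney covering for an abstract time weight [sigma] *)

Section whitney_balls.
Context {R : realType} {n : nat}.
Variables (E : set (spacetime R n)) (sigma : spacetime R n -> R) (K : R).
Implicit Types (z w u : spacetime R n) (c : R).

(** For [sigma] the intrinsic time weight, [wdist] and [wradius] unfold to [intrinsic_dist] and
    [whitney_radius]. *)
Definition wdist z w u : R := para_dist (sigma z) w u.

Definition wradius z : R := inf [set wdist z z w | w in E] / 4.

Definition wball c z : set (spacetime R n) := [set w | wdist z z w < c * wradius z].

Hypothesis E_neq0 : E !=set0.
Hypothesis E_closed : forall z, ~ E z -> exists2 rho, 0 < rho &
  forall w, enorm (w.1 - z.1) < rho -> `|w.2 - z.2| < rho -> ~ E w.
Hypothesis sigma_gt0 : forall z, ~ E z -> 0 < sigma z.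
Hypothesis K_ge1 : 1 <= K.
(** The only link to the double phase structure: the metrics at neighbours differ by at most the
    factor 2 K. *)
Hypothesis sigma_comparable : forall z w, ~ E z -> ~ E w ->
  wball 2 z `&` wball 2 w !=set0 -> sigma z <= (2 * K) ^+ 2 * sigma w.

Let dists z : set R := [set wdist z z w | w in E].

Let has_inf_dists z : has_inf (dists z).
Proof.
split; first by have [w Ew] := E_neq0; exists (wdist z z w), w.
by exists 0 => _ [w _ <-]; exact: para_dist_ge0.
Qed.

Lemma wradius_le z w : E w -> 4 * wradius z <= wdist z z w.
Proof.
move=> Ew; rewrite /wradius mulrC divfK//.
by apply: ge_inf; [exact: (has_inf_dists z).2|exists w].
Qed.

Lemma wradius_lt z c : 4 * wradius z < c -> exists2 w, E w & wdist z z w < c.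
Proof.
rewrite /wradius mulrC divfK// => /(inf_lt (has_inf_dists z).1)[_ [w Ew <-] wc].
by exists w.
Qed.

Lemma wradius_gt0 z : ~ E z -> 0 < wradius z.
Proof.
move=> nEz; have [rho rho0 Erho] := E_closed nEz; have s0 := sigma_gt0 nEz.
(* In the metric at [z] the ball of radius [m] lies in the box of size [rho] that avoids [E]. *)
rewrite divr_gt0//; pose m := Num.min rho (Num.sqrt (sigma z * rho)).
have m0 : 0 < m by rewrite lt_min rho0 sqrtr_gt0 mulr_gt0.
apply: (lt_le_trans m0); apply: lb_le_inf; first exact: (has_inf_dists z).1.
move=> _ [w Ew <-]; rewrite leNgt; apply/negP.
rewrite /wdist para_dist_lt ?(ltW s0)// => /andP[wx wt].
have mrho : m <= rho by rewrite ge_min lexx.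
have m2 : m ^+ 2 <= sigma z * rho.
  have /sqr_sqrtr <- : 0 <= sigma z * rho by rewrite ltW// mulr_gt0.
  apply: lerXn2r; rewrite ?nnegrE ?sqrtr_ge0 ?(ltW m0)//.
  by rewrite ge_min lexx orbT.
apply: (Erho w) Ew; first by rewrite enormBC (lt_le_trans wx).
by rewrite distrC -(ltr_pM2l s0) (lt_le_trans wt).
Qed.

Lemma wball_self c z : ~ E z -> 0 < c -> wball c z z.
Proof.
by move=> nEz c0; rewrite /wball/= /wdist para_distxx mulr_gt0// wradius_gt0.
Qed.

Lemma wball_sub c c' z : ~ E z -> c <= c' -> wball c z `<=` wball c' z.
Proof.
move=> nEz cc w; rewrite /wball/= => /lt_le_trans; apply.
by rewrite ler_wpM2r// ltW// wradius_gt0.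
Qed.

Lemma wball4_sub z : ~ E z -> wball 4 z `<=` ~` E.
Proof. by move=> nEz w /= /[swap] /(wradius_le z); rewrite leNgt => /negP. Qed.

Lemma wball5_meets z : ~ E z -> wball 5 z `&` E !=set0.
Proof.
move=> nEz; have r0 := wradius_gt0 nEz.
have [w Ew wz] := @wradius_lt z (5 * wradius z) ltac:(lra).
by exists w.
Qed.

(** A point of [E] almost nearest to [w] has distance at least 4 r_z from [z]; the path to it runs
    through a common point of the two balls, where the metric at [z] is exchanged for [C] times that
    at [w]. *)
Lemma wradius_compare c C z w : ~ E z -> ~ E w -> 0 <= c -> 1 <= C ->
  wball c z `&` wball c w !=set0 -> sigma z <= C ^+ 2 * sigma w ->
  (4 - c) * wradius z <= C * ((4 + c) * wradius w).
Proof.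
move=> nEz nEw c0 C1 [y [yz yw]] szw; rewrite leNgt; apply/negP => lt.
have sz := sigma_gt0 nEz; have sw := sigma_gt0 nEw.
have C0 : 0 < C by lra.
(* The value for which the triangle inequality through the common point closes up exactly. *)
pose rho := C^-1 * ((4 - c) * wradius z) - c * wradius w.
have : 4 * wradius w < rho.
  by rewrite ltrBrDr -mulrDl ltr_pdivlMl.
move=> /wradius_lt[e Ee ew].
have ze := wradius_le z Ee.
have t1 := para_dist_triangle z y e (ltW sz).
have t2 := para_dist_scale y e (ltW sw) C1 szw.
have t3 := para_dist_triangle y w e (ltW sw).
have t4 : C * para_dist (sigma w) y e <= C * (para_dist (sigma w) y w + para_dist (sigma w) w e).
  by rewrite ler_pM2l.
have t5 : C * (para_dist (sigma w) y w + para_dist (sigma w) w e) <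
    C * (c * wradius w + rho).
  by rewrite ltr_pM2l// ltrD// para_distC.
have t6 : C * (c * wradius w + rho) = (4 - c) * wradius z.
  by rewrite /rho; field; rewrite gt_eqF.
move: yz ze; rewrite /wball/= /wdist => yz ze; lra.
Qed.

(* The distances at [z] and [w] compare with constants [C] and [C'] one of which
   is [1]: only one factor [2 K] is lost in going back and forth. *)
Lemma sigma_ratio z w : ~ E z -> ~ E w -> wball 2 z `&` wball 2 w !=set0 ->
  exists C C', [/\ 1 <= C, 1 <= C', C * C' <= 2 * K,
    sigma z <= C ^+ 2 * sigma w & sigma w <= C' ^+ 2 * sigma z].
Proof.
move=> nEz nEw zw; have K2 : 1 <= 2 * K by move: K_ge1; lra.
have zw2 := sigma_comparable nEz nEw zw.
have wz2 := sigma_comparable nEw nEz; rewrite setIC in wz2.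
have [szw|/ltW swz] := leP (sigma z) (sigma w).
  by exists 1, (2 * K); rewrite expr1n !mul1r; split => //; exact: wz2.
by exists (2 * K), 1; rewrite expr1n mulr1 mul1r.
Qed.

(** [wradius_compare] with c = 2 and C = 2 K: the ratio is 2 K (4 + 2) / (4 - 2) = 6 K. *)
Lemma wradius_neighbour z w : ~ E z -> ~ E w -> wball 2 z `&` wball 2 w !=set0 ->
  wradius z <= 6 * K * wradius w.
Proof.
move=> nEz nEw zw; have K1 := K_ge1.
have K2 : 1 <= 2 * K by lra.
have := wradius_compare nEz nEw (ler0n _ 2) K2 zw (sigma_comparable nEz nEw zw).
have -> : 2 * K * ((4 + 2) * wradius w) = 2 * (6 * K * wradius w) by ring.
by move: (6 * K * _) => a; lra.
Qed.

(** Through a common point the distance is at most 2 r_z + 4 C r_w, and [wradius_compare] bounds C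
    r_w by 3 C C' r_z <= 6 K r_z, in total at most 26 K r_z. Bounding [C] and [C'] by 2 K separately
    would be quadratic in [K]. *)
Lemma wball_neighbour z w : ~ E z -> ~ E w -> wball 2 z `&` wball 2 w !=set0 ->
  wball 2 w `<=` wball (50 * K) z.
Proof.
move=> nEz nEw zw u uw; have K1 := K_ge1; have [C [C' [C1 C'1 CC szw swz]]] := sigma_ratio nEz nEw zw.
have wz : wball 2 w `&` wball 2 z !=set0 by rewrite setIC.
have rwz := wradius_compare nEw nEz (ltW (ltr0n _ 2)) C'1 wz swz.
have sz := sigma_gt0 nEz; have sw := sigma_gt0 nEw.
have rz := wradius_gt0 nEz; have rw := wradius_gt0 nEw.
case: zw => y [yz yw].
have t1 := para_dist_triangle z y u (ltW sz).
have t2 := para_dist_scale y u (ltW sw) C1 szw.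
have t3 := para_dist_triangle y w u (ltW sw).
have t4 : C * para_dist (sigma w) y u <= C * (4 * wradius w).
  rewrite ler_pM2l; last by lra.
  move: yw uw; rewrite /wball/= /wdist para_distC => yw uw; lra.
have t5 : C * ((4 - 2) * wradius w) <= C * (C' * ((4 + 2) * wradius z)).
  by rewrite ler_pM2l//; lra.
have t6 : C * C' * wradius z <= 2 * K * wradius z by rewrite ler_pM2r.
have t7 : 1 * wradius z <= K * wradius z by rewrite ler_pM2r.
move: yz; rewrite /wball/= /wdist => yz.
have e5 : C * (C' * ((4 + 2) * wradius z)) = 6 * (C * C' * wradius z) by ring.
have e6 : C * ((4 - 2) * wradius w) = 2 * (C * wradius w) by ring.
have e7 : C * (4 * wradius w) = 4 * (C * wradius w) by ring.
lra.
Qed.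

(** With c = 1 / (6 K) <= 1 / 6 the comparison of radii gives C r_w <= 25 / 23 times 2 K r_z;
    multiplied by [c] this is 25 / 69 r_z, and 1 / 6 + 25 / 69 < 1. *)
Lemma wball_cover z w : ~ E z -> ~ E w ->
  wball (6 * K)^-1 z `&` wball (6 * K)^-1 w !=set0 -> wball 1 z w.
Proof.
move=> nEz nEw zw; have K1 := K_ge1; pose c := (6 * K)^-1.
have K0 : 0 < K by lra.
have c0 : 0 < c by rewrite invr_gt0; lra.
have c1 : c <= 6^-1 by rewrite lef_pV2 ?posrE//; lra.
have cK : c * K = 6^-1 by rewrite /c; field; rewrite gt_eqF.
have zw2 : wball 2 z `&` wball 2 w !=set0.
  case: zw => y [yz yw]; exists y.
  by split; [move: yz|move: yw]; apply: wball_sub => //; rewrite -/c; lra.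
have [C [C' [C1 C'1 CC szw swz]]] := sigma_ratio nEz nEw zw2.
have wz : wball c w `&` wball c z !=set0 by rewrite setIC.
have rwz := wradius_compare nEw nEz (ltW c0) C'1 wz swz.
have sz := sigma_gt0 nEz; have sw := sigma_gt0 nEw.
have rz := wradius_gt0 nEz; have rw := wradius_gt0 nEw.
case: zw => y [yz yw].
have t1 := para_dist_triangle z y w (ltW sz).
have t2 := para_dist_scale y w (ltW sw) C1 szw.
have t4 : C * para_dist (sigma w) y w <= C * (c * wradius w).
  by rewrite ler_pM2l; [move: yw; rewrite /wball/= /wdist para_distC => /ltW|lra].
have t5 : C * ((4 - c) * wradius w) <= C * (C' * ((4 + c) * wradius z)).
  by rewrite ler_pM2l//; lra.
have t6 : C * C' * wradius z <= 2 * K * wradius z by rewrite ler_pM2r.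
have rw' : 23 / 6 * wradius w <= (4 - c) * wradius w by rewrite ler_pM2r//; lra.
have rz' : (4 + c) * wradius z <= 25 / 6 * wradius z by rewrite ler_pM2r//; lra.
have t7 : 23 / 6 * (C * wradius w) <= 25 / 6 * (2 * K * wradius z).
  apply: (@le_trans _ _ (C * ((4 - c) * wradius w))).
    have -> : 23 / 6 * (C * wradius w) = C * (23 / 6 * wradius w) by ring.
    by rewrite ler_pM2l//; lra.
  apply: (le_trans t5); rewrite mulrA.
  apply: (@le_trans _ _ (C * C' * (25 / 6 * wradius z))).
    by rewrite ler_pM2l// mulr_gt0//; lra.
  by rewrite mulrCA ler_pM2l//; lra.
have t8 : c * (C * wradius w) <= c * (25 / 23 * (2 * K * wradius z)).
  by rewrite ler_pM2l//; lra.
have e8 : c * (25 / 23 * (2 * K * wradius z)) = 25 / 69 * wradius z.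
  have -> : c * (25 / 23 * (2 * K * wradius z)) = 50 / 23 * (c * K) * wradius z.
    by ring.
  by rewrite cK; congr (_ * _); lra.
have e9 : C * (c * wradius w) = c * (C * wradius w) by ring.
have t9 : c * wradius z <= 6^-1 * wradius z by rewrite ler_pM2r.
move: yz; rewrite /wball/= /wdist -/c => yz; lra.
Qed.

Local Notation core := (wball (6 * K)^-1).

Let coreK : 0 < (6 * K)^-1.
Proof. by rewrite invr_gt0; move: K_ge1; lra. Qed.

Let rational_point (q : 'rV[rat]_n * rat) : spacetime R n :=
  (\row_i ratr (q.1 ord0 i), ratr q.2).

Let rational_near z (d : R) : 0 < d -> exists q, let w := rational_point q in
  enorm (z.1 - w.1) <= n%:R * d /\ `|z.2 - w.2| <= d.
Proof.
move=> d0.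
have near (x : R) : exists q : rat, `|x - ratr q| <= d.
  have [|q] := @rat_in_itvoo R (x - d) (x + d); first lra.
  by rewrite in_itv/= -ltr_distl distrC => /ltW; exists q.
have [qx qxP] := choice (fun i => near (z.1 ord0 i)); have [qt qtP] := near z.2.
exists (\row_i qx i, qt); split => //=.
by apply: enorm_le => [|i]; [exact: ltW|rewrite !mxE].
Qed.

Let rational_in_core z : ~ E z -> exists q, core z (rational_point q).
Proof.
move=> nEz; have s0 := sigma_gt0 nEz; have r0 := wradius_gt0 nEz.
pose c := (6 * K)^-1 * wradius z; have c0 : 0 < c by rewrite mulr_gt0.
pose d := Num.min (c / n.+1%:R) (c ^+ 2 / (2 * sigma z)).
have d0 : 0 < d by rewrite lt_min !divr_gt0// ?exprn_gt0// mulr_gt0.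
have [q [qx qt]] := rational_near z d0; exists q.
rewrite /wball/= /wdist para_dist_lt ?(ltW s0)// -/c; apply/andP; split.
  apply: le_lt_trans qx _; apply: (@le_lt_trans _ _ (n%:R * (c / n.+1%:R))).
    by rewrite ler_wpM2l// ge_min lexx.
  by rewrite mulrCA gtr_pMr// ltr_pdivrMr// mul1r ltr_nat.
apply: (@le_lt_trans _ _ (sigma z * (c ^+ 2 / (2 * sigma z)))).
  by rewrite ler_pM2l// (le_trans qt)// ge_min lexx orbT.
have -> : sigma z * (c ^+ 2 / (2 * sigma z)) = c ^+ 2 / 2.
  by field; rewrite gt_eqF.
have : 0 < c ^+ 2 by rewrite exprn_gt0.
by move: (c ^+ 2) => u; lra.
Qed.

(** Each core contains a rational point, and disjoint cores contain different ones. *)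
Let disjoint_countable (F : set (spacetime R n)) :
  F `<=` ~` E -> trivIset F core -> countable F.
Proof.
move=> FE tF.
have ex z : exists q, F z -> core z (rational_point q).
  have [Fz|nFz] := pselect (F z); last by exists 0.
  by have [q qz] := rational_in_core (FE _ Fz); exists q.
have [f fP] := choice ex; apply/countable_injP; exists (choice.pickle \o f).
move=> z w; rewrite !inE => Fz Fw /= /(pcan_inj choice.pickleK) fzw.
apply: tF => //; exists (rational_point (f z)); split; first exact: fP.
by rewrite fzw; exact: fP.
Qed.

(* A topmost member of a finite family would have its top point, which still
   lies off [E], uncovered. *)
Let cover_infinite (F : set (spacetime R n)) : ~` E !=set0 ->
  F `<=` ~` E -> (forall z, ~ E z -> exists2 w, F w & wball 1 w z) ->
  infinite_set F.
Proof.
move=> [z0 nEz0] FE cov finF.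
pose top z : R := z.2 + wradius z ^+ 2 / sigma z.
have [s Fs] := (finite_seqP F).1 finF.
have [z Fz maxz] : exists2 z, F z & forall w, F w -> top w <= top z.
  have [w0 Fw0 _] := cov _ nEz0; move: Fw0; rewrite Fs /=.
  elim: (s) w0 => // w t IH w0 _.
  have [t0|] := eqVneq t [::].
    exists w => [|u]; first by rewrite /= mem_head.
    by rewrite t0 /= inE => /eqP ->.
  case: t IH => // w1 t IH _; have [u ut maxu] := IH w1 (mem_head _ _).
  have [uw|wu] := leP (top u) (top w).
    exists w => [|v /=]; first by rewrite /= mem_head.
    by rewrite in_cons => /orP[/eqP -> //|/maxu /le_trans]; exact.
  exists u => [|v /=]; first by rewrite /= in_cons [X in _ || X]ut orbT.
  by rewrite in_cons => /orP[/eqP ->|/maxu//]; exact: ltW.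
have nEz := FE _ Fz; have s0 := sigma_gt0 nEz; have r0 := wradius_gt0 nEz.
pose y : spacetime R n := (z.1, top z).
have : wball 4 z y.
  have r4 : 0 < 4 * wradius z by rewrite pmulr_rgt0.
  rewrite /wball/= /wdist para_dist_lt ?(ltW s0)//.
  rewrite subrr enorm0 r4 /= /y /top/= opprD addNKr normrN.
  rewrite ger0_norm ?divr_ge0 ?exprn_ge0 ?ltW// mulrC divfK ?gt_eqF//.
  have -> : (4 * wradius z) ^+ 2 = 16 * wradius z ^+ 2 by ring.
  have : 0 < wradius z ^+ 2 by rewrite exprn_gt0.
  by move: (_ ^+ 2) => v; lra.
move=> /(wball4_sub nEz)/cov[w Fw].
have nEw := FE _ Fw; have sw := sigma_gt0 nEw; have rw := wradius_gt0 nEw.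
rewrite /wball/= /wdist mul1r para_dist_lt ?(ltW sw)// => /andP[_].
rewrite distrC mulrC -ltr_pdivlMr// => /(le_lt_trans (ler_norm _)).
rewrite ltrBlDl => /lt_le_trans/(_ (maxz _ Fw)).
by rewrite ltxx.
Qed.

(** Maximality suffices: a point whose core meets a chosen core is covered by [wball_cover], and a
    point whose core meets none could be added to the family. *)
Lemma whitney_cover : ~` E !=set0 -> exists Z : nat -> spacetime R n,
  [/\ forall i, ~ E (Z i), \bigcup_i wball 1 (Z i) = ~` E &
    forall i j, i <> j -> wball (6 * K)^-1 (Z i) `&` wball (6 * K)^-1 (Z j) = set0].
Proof.
move=> E_neqT.
have [F [FE tF maxF]] := ex_maximal_disjoint_subcollection core (~` E).
have cov z : ~ E z -> exists2 w, F w & wball 1 w z.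
  move=> nEz; apply: contrapT => nw.
  have nF : ~ F z.
    by move=> Fz; apply: nw; exists z => //; exact: wball_self.
  apply: (maxF (F `|` [set z])).
  - split; first by move=> w; left.
    by move=> /(_ z (or_intror erefl)).
  - by move=> w [/FE//|->].
  have far w : F w -> core w `&` core z !=set0 -> False.
    by move=> Fw wz; apply: nw; exists w => //; apply: wball_cover => //; exact: FE.
  move=> w u [Fw|->] [Fu|->] //; first exact: tF.
    by move=> /(far _ Fw).
  by rewrite setIC => /(far _ Fu).
have cF := disjoint_countable FE tF.
have iF := cover_infinite E_neqT FE cov.
(* An enumeration with repetitions would violate disjointness for distinct indices, so [F] must be
   infinite to be indexed by all of [nat]. *)
have : ([set: nat] #= F)%card.
  by rewrite card_eq_le; apply/andP; split; [exact/infiniteP|exact: cF].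
move=> /card_set_bijP[Z [Zf Zinj Zsurj]].
have nEZ i : ~ E (Z i) by apply: FE; exact: Zf.
exists Z; split => //.
  apply/seteqP; split=> [z [i _ /(wball_sub (nEZ i) (ler1n _ 4))]|z /cov[w Fw wz]].
    exact: wball4_sub.
  by have [i _ iw] := Zsurj _ Fw; exists i => //; rewrite iw.
move=> i j ij; apply: contrapT => /eqP/set0P ne; apply: ij.
apply: Zinj; rewrite ?inE//; apply: tF => //; exact: Zf.
Qed.

(** * Volumes of neighbours and the packing bound *)

Local Notation mass z := (wradius z ^+ n.+2 / sigma z).

Let mass_gt0 z : ~ E z -> 0 < mass z.
Proof. by move=> nEz; rewrite divr_gt0 ?exprn_gt0 ?sigma_gt0 ?wradius_gt0. Qed.

Lemma wball_volume c z : ~ E z -> 0 < c -> lebesgue_st (wball c z) =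
  (2 * unit_ball_volume (R := R) (n := n) * c ^+ n.+2 *
    (wradius z ^+ n.+2 / sigma z))%:E.
Proof.
move=> nEz c0; rewrite /wball /wdist para_ball_volume ?sigma_gt0//; last first.
  by rewrite mulr_gt0// wradius_gt0.
by rewrite exprMn !mulrA.
Qed.

Lemma measurable_wball c z : ~ E z -> 0 < c ->
  measurable (wball c z : set ('rV[R]_n * measurableTypeR R)).
Proof.
move=> nEz c0; apply: measurable_para_ball; first exact: sigma_gt0.
by rewrite mulr_gt0// wradius_gt0.
Qed.

(** The power of 6 K comes from the radii, the square of 2 K from the time weights. *)
Definition mass_ratio := (6 * K) ^+ n.+2 * (2 * K) ^+ 2.

Let mass_ratio_gt0 : 0 < mass_ratio.
Proof. by have K1 := K_ge1; rewrite mulr_gt0// exprn_gt0//; lra. Qed.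

Let mass_neighbour z w : ~ E z -> ~ E w -> wball 2 z `&` wball 2 w !=set0 ->
  mass z <= mass_ratio * mass w.
Proof.
move=> nEz nEw zw; have K1 := K_ge1.
have rr := wradius_neighbour nEz nEw zw.
have ss : sigma w <= (2 * K) ^+ 2 * sigma z.
  by apply: sigma_comparable => //; rewrite setIC.
have sz := sigma_gt0 nEz; have sw := sigma_gt0 nEw; have rz := wradius_gt0 nEz.
have rw := wradius_gt0 nEw.
have -> : mass_ratio * mass w =
    (6 * K * wradius w) ^+ n.+2 * ((2 * K) ^+ 2 / sigma w).
  by rewrite /mass_ratio [(6 * K * wradius w) ^+ _]exprMn mulrACA.
apply: ler_pM; rewrite ?exprn_ge0 ?invr_ge0 ?(ltW sz) ?(ltW rz)//.
  by apply: lerXn2r => //; rewrite nnegrE ltW// (lt_le_trans rz).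
by rewrite ler_pdivlMr// mulrC ler_pdivrMr.
Qed.

Lemma wball_volume_neighbour z w : ~ E z -> ~ E w ->
  wball 2 z `&` wball 2 w !=set0 ->
  (lebesgue_st (wball 1 z) <= mass_ratio%:E * lebesgue_st (wball 1 w))%E.
Proof.
move=> nEz nEw zw; rewrite !wball_volume// -EFinM lee_fin expr1n !mulr1 [leRHS]mulrCA.
rewrite ler_pM2l; first exact: mass_neighbour.
by rewrite mulr_gt0 ?unit_ball_volume_gt0.
Qed.

Section packing.
Variable Z : nat -> spacetime R n.
Hypothesis nEZ : forall i, ~ E (Z i).
Hypothesis disjointZ : forall i j, i <> j -> core (Z i) `&` core (Z j) = set0.

Definition packing_number := (50 * K) ^+ n.+2 * (6 * K) ^+ n.+2 * mass_ratio.

Local Notation meeting i := [set j | wball 2 (Z i) `&` wball 2 (Z j) !=set0].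

(** The cores of the neighbours are disjoint, lie in the 50 K-fold ball of [Z i], and have volume at
    least [m]; comparing volumes bounds their number. *)
Let packing (J : {fset nat}) i : [set` J] `<=` meeting i ->
  #|` J|%fset%:R <= packing_number.
Proof.
move=> JI; have K1 := K_ge1; pose V := 2 * unit_ball_volume (R := R) (n := n).
have V0 : 0 < V by rewrite mulr_gt0// unit_ball_volume_gt0.
have K50 : 0 < 50 * K by lra.
have core_sub (j : nat) : j \in J -> core (Z j) `<=` wball (50 * K) (Z i).
  move=> Jj u uj.
  have ij : wball 2 (Z i) `&` wball 2 (Z j) !=set0 by exact: JI.
  apply: (wball_neighbour (@nEZ i) (@nEZ j) ij).
  apply: wball_sub uj => //; apply: (@le_trans _ _ 1); last by lra.
  by rewrite invf_le1; lra.
pose m := V * (6 * K)^-1 ^+ n.+2 * (mass_ratio^-1 * mass (Z i)).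
have le_core (j : nat) : j \in J -> (m%:E <= lebesgue_st (core (Z j)))%E.
  move=> Jj; rewrite wball_volume// lee_fin -/V ler_pM2l.
    by rewrite ler_pdivrMl//; apply: mass_neighbour => //; exact: JI.
  by apply: mulr_gt0 => //; exact: exprn_gt0.
have sum_le : (\sum_(j <- J) lebesgue_st (core (Z j)) <=
    lebesgue_st (wball (50 * K) (Z i)))%E.
  rewrite fsbig_seq// -measure_fin_bigcup//.
  - apply: le_measure; rewrite ?inE; [|exact: measurable_wball|].
      by apply: fin_bigcup_measurable => // j1 _; exact: measurable_wball.
    by move=> z [j1 Jj zj]; exact: core_sub zj.
  - by apply/trivIsetP => j1 j2 _ _ /eqP; exact: disjointZ.
  - by move=> j1 _; exact: measurable_wball.
have : ((#|` J|%fset%:R * m)%:E <= lebesgue_st (wball (50 * K) (Z i)))%E.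
  apply: le_trans sum_le; rewrite mulr_natl -count_predT.
  rewrite -[m *+ _]addr0 -iter_addr -big_const_seq -sumEFin.
  by rewrite big_seq [leRHS]big_seq; apply: lee_sum => j1; exact: le_core.
rewrite wball_volume// lee_fin -/V => Jm.
have m0 : 0 < m.
  apply: mulr_gt0; first by apply: mulr_gt0 => //; exact: exprn_gt0.
  by apply: mulr_gt0; [rewrite invr_gt0|exact: mass_gt0].
rewrite -(ler_pM2r m0); apply: le_trans Jm _.
rewrite le_eqVlt; apply/orP; left; apply/eqP; rewrite /packing_number /m.
rewrite exprVn; field.
have K6 : 0 < (6 * K) ^+ n.+2 by apply: exprn_gt0; lra.
by rewrite !gt_eqF//; exact: sigma_gt0 (@nEZ i).
Qed.

Lemma finite_meeting i : finite_set (meeting i) /\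
  #|` fset_set (meeting i)|%fset%:R <= packing_number.
Proof.
have fin : finite_set (meeting i).
  apply: contrapT => inf.
  (* A finite subset with more elements than the bound allows. *)
  have [J JI cJ] := infinite_set_fset (Num.truncn packing_number).+1 inf.
  have := packing JI; rewrite leNgt => /negP; apply.
  apply: (lt_le_trans (truncnS_gt packing_number)).
  by rewrite ler_nat.
by split=> //; apply: packing; rewrite fset_setK//; exact: subset_refl.
Qed.

End packing.

End whitney_balls.

(** * The intrinsic scaling *)

Section powers.
Context {R : realType}.
Implicit Types x y c p s : R.

(** Raising to the power s / p, which is at most 1, does not increase a constant [c >= 1]. *)
Lemma powR_ratio x y c p s : 0 < x -> 0 < y -> 1 <= c -> 0 < p -> 0 <= s <= p ->
  x `^ p <= c * y `^ p -> x `^ s <= c * y `^ s.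
Proof.
move=> x0 y0 c1 p0 /andP[s0 sp] xy.
have e u : 0 < u -> (u `^ p) `^ (s / p) = u `^ s.
  by move=> u0; rewrite -powRrM mulrCA divff ?gt_eqF// mulr1.
rewrite -(e x)// -(e y)//.
have sp0 : 0 <= s / p by rewrite divr_ge0// ltW.
have c0 : 0 <= c by lra.
apply: (@le_trans _ _ ((c * y `^ p) `^ (s / p))).
  apply: ge0_ler_powR => //; first by rewrite nnegrE powR_ge0.
  by rewrite nnegrE mulr_ge0 ?powR_ge0.
rewrite powRM ?powR_ge0// ler_wpM2r ?powR_ge0// ler1_powR//.
by rewrite ler_pdivrMr// mul1r.
Qed.

Lemma powR_root_le x y c p s : 0 < x -> 0 < y -> 0 <= c -> 0 < p ->
  x `^ p <= c `^ s * y `^ p -> x <= c `^ (s / p) * y.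
Proof.
move=> x0 y0 c0 p0 xy.
have e u : 0 < u -> (u `^ p) `^ p^-1 = u.
  by move=> u0; rewrite -powRrM divff ?gt_eqF// powRr1// ltW.
rewrite -{1}(e x)// -(e y)// powRrM -powRM ?powR_ge0//.
by rewrite ge0_ler_powR ?nnegrE ?mulr_ge0 ?powR_ge0// invr_ge0 ltW.
Qed.

(** A number in [0, 1] is at most its [s]-th power; this is summed for the fractions x / (x + y) and
    y / (x + y). *)
Lemma powR_subadd x y s : 0 <= x -> 0 <= y -> 0 < s -> s <= 1 ->
  (x + y) `^ s <= x `^ s + y `^ s.
Proof.
move=> x0 y0 s0 s1; have [/eqP|xy] := eqVneq (x + y) 0.
  rewrite paddr_eq0// => /andP[/eqP -> /eqP ->].
  by rewrite addr0 powR0 ?gt_eqF// addr0.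
have xy0 : 0 < x + y by rewrite lt_neqAle eq_sym xy addr_ge0.
have part u : 0 <= u -> u <= x + y -> u / (x + y) * (x + y) `^ s <= u `^ s.
  move=> u0 uxy; have [->|un0] := eqVneq u 0; first by rewrite !mul0r powR_ge0.
  have up : 0 < u by rewrite lt_neqAle eq_sym un0.
  rewrite -[in leRHS](divfK xy u) powRM ?divr_ge0 ?(ltW xy0)//.
  rewrite ler_wpM2r ?powR_ge0// ger1_powR// divr_gt0//=.
  by rewrite ler_pdivrMr// mul1r.
apply: le_trans (lerD (part x x0 _) (part y y0 _)); rewrite ?lerDl ?lerDr//.
by rewrite -mulrDl -mulrDl divff// mul1r.
Qed.

End powers.

(** * The root lambda and its variation between nearby points *)

Section intrinsic_lambda.
Context {R : realType} {n : nat}.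
Variables (p q alpha A Lam kappa K : R) (b : spacetime R n -> R).
Implicit Types z w : spacetime R n.
Hypotheses (p2 : 2 <= p) (pq : p < q) (alpha0 : 0 < alpha) (alpha1 : alpha <= 1).
Hypothesis A0 : 0 < A.
Hypothesis b0 : forall z, 0 <= b z.
Hypothesis b_lt : forall z, 1 + b z < Lam.
Hypothesis b_holder : forall z w, `|b z - b w| <=
  A * (enorm (z.1 - w.1) `^ alpha + `|z.2 - w.2| `^ (alpha / 2)).
Hypothesis kappa0 : 0 <= kappa.
Hypothesis KE : Num.sqrt 2 + 200 * kappa <= K.

Local Notation l := (lambda p q Lam b).
Local Notation isQ := (p_phase p q Lam K b).

Definition intrinsic_scale z : R :=
  if isQ z then l z `^ (p - 2) else Lam * l z ^- 2.

Let Lam1 : 1 < Lam.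
Proof. by have := b_lt 0; have := b0 0; lra. Qed.

Let sqrt2_ge1 : 1 <= Num.sqrt 2 :> R.
Proof. by rewrite -[leLHS]sqrtr1 ler_sqrt ?ler1n. Qed.

Let k200 : 0 <= 200 * kappa.
Proof. exact: mulr_ge0 (ler0n _ 200) kappa0. Qed.

(** The summand sqrt 2 of [K] supplies the 2, and its cross term with 200 kappa the linear term. *)
Let K2 : 2 + 200 * kappa <= K ^+ 2.
Proof.
have s2 : Num.sqrt 2 ^+ 2 = 2 :> R by rewrite sqr_sqrtr.
have s1 := sqrt2_ge1; move: k200 KE; move: (200 * kappa) => k k0 kK.
have sk : k <= Num.sqrt 2 * k by rewrite ler_peMl.
have kk : 0 <= k * k by rewrite mulr_ge0.
apply: (@le_trans _ _ ((Num.sqrt 2 + k) ^+ 2)).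
  have -> : (Num.sqrt 2 + k) ^+ 2 = 2 + 2 * (Num.sqrt 2 * k) + k * k.
    by rewrite sqrrD s2; ring.
  lra.
by apply: lerXn2r => //; rewrite nnegrE; lra.
Qed.

Lemma K_ge1 : 1 <= K.
Proof. by move: k200 KE sqrt2_ge1; move: (200 * kappa) => k; lra. Qed.

(** Intermediate value theorem between 1 and [Lam]: the left side is 1 + b z < Lam at 1 and at least
    [Lam] at [Lam]; strictness at 1 excludes that endpoint. Existence makes [get] return a root. *)
Lemma lambdaP z : 1 < l z /\ l z `^ p + b z * l z `^ q = Lam.
Proof.
rewrite /lambda.
suff [u u1 uE] : exists2 u, 1 < u & u `^ p + b z * u `^ q = Lam.
  by apply: (@getPex _ [set l : R | 1 < l /\ l `^ p + b z * l `^ q = Lam]); exists u.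
pose f u := u `^ p + b z * u `^ q.
have cf : {within `[1, Lam], continuous f}.
  apply: derivable_within_continuous => u; rewrite in_itv/= => /andP[u1 _].
  have u0 : u \in `]0, +oo[%R by rewrite in_itv/= andbT; lra.
  by apply: derivableD; [|apply: derivableM => //]; exact: derivable_powR.
have [|u] := IVT (ltW Lam1) cf (v := Lam) _.
  rewrite /f !powR1 mulr1 ge_min le_max; apply/andP; split; apply/orP.
    by left; rewrite ltW// b_lt.
  right; apply: (@le_trans _ _ (Lam `^ p)).
    by apply: le1r_powR; [exact: ltW|apply: le_trans p2; rewrite ler1n].
  by rewrite lerDl mulr_ge0// powR_ge0.
rewrite in_itv/= => /andP[u1 _] uE; exists u => //.
rewrite lt_neqAle u1 andbT; apply/eqP => u1'; move: uE.
by rewrite -u1' /f !powR1 mulr1 => uE; have := b_lt z; rewrite uE ltxx.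
Qed.

Let l0 z : 0 < l z.
Proof. by case: (lambdaP z) => l1 _; lra. Qed.

Local Notation P z := (l z `^ p).
Local Notation Q z := (l z `^ q).
(** The value of the coefficient at which the two terms would balance, since [D z * Q z = P z]; it
    decreases in lambda. *)
Local Notation D z := (l z `^ (p - q)).

Let P0 z : 0 < P z. Proof. exact: powR_gt0. Qed.
Let Q0 z : 0 < Q z. Proof. exact: powR_gt0. Qed.
Let D0 z : 0 < D z. Proof. exact: powR_gt0. Qed.

Let PE z : P z + b z * Q z = Lam. Proof. exact: (lambdaP z).2. Qed.

Let DQ z : D z * Q z = P z.
Proof. by rewrite -powRD ?subrK// (gt_eqF (l0 z)) implybT. Qed.

Let p0 : 0 < p. Proof. by have := p2; lra. Qed.
Let q0 : 0 < q. Proof. exact: lt_trans pq. Qed.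

Let powR_mono s z w : 0 <= s -> l z <= l w -> l z `^ s <= l w `^ s.
Proof.
by move=> s0 zw; apply: ge0_ler_powR; rewrite ?nnegrE ?(ltW (l0 _)).
Qed.

Let D_anti z w : l w <= l z -> D z <= D w.
Proof.
move=> wz; rewrite -opprB !powRN lef_pV2 ?posrE ?powR_gt0//.
by apply: powR_mono => //; rewrite subr_ge0 ltW.
Qed.

(** [P z <= Lam] makes the weight of the G phase the larger one; with [scale_le] this brackets the
    weight independently of the phase. *)
Lemma scale_ge z : l z `^ (p - 2) <= intrinsic_scale z.
Proof.
rewrite /intrinsic_scale; case: ifPn => // _.
rewrite ler_pdivlMr ?exprn_gt0// -powR_mulrn ?(ltW (l0 _))// -powRD; last first.
  by rewrite (gt_eqF (l0 z)) implybT.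
by rewrite subrK -[leRHS](PE z) lerDl mulr_ge0// ltW.
Qed.

Lemma scale_le z : intrinsic_scale z <= Lam * l z ^- 2.
Proof.
have := scale_ge z; rewrite /intrinsic_scale; case: ifPn => // _ _.
rewrite ler_pdivlMr ?exprn_gt0// -powR_mulrn ?(ltW (l0 _))// -powRD; last first.
  by rewrite (gt_eqF (l0 z)) implybT.
by rewrite subrK -[leRHS](PE z) lerDl mulr_ge0// ltW.
Qed.

Lemma scale_ge1 z : 1 <= intrinsic_scale z.
Proof.
apply: le_trans (scale_ge z); rewrite -[leLHS](powRr0 (l z)).
by apply: ler_powR; [exact: (ltW (lambdaP z).1)|rewrite subr_ge0].
Qed.

Lemma scale_gt0 z : 0 < intrinsic_scale z.
Proof. exact: lt_le_trans ltr01 (scale_ge1 z). Qed.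

Definition small_radius z r := A * (4 * r) `^ alpha * l z `^ q <= kappa * l z `^ p.

Let smallD z r : small_radius z r -> A * (4 * r) `^ alpha <= kappa * D z.
Proof. by rewrite /small_radius -DQ mulrA ler_pM2r. Qed.

(** [2 * r + 2 * r'] is at most 4 times the larger radius, which is why [small_radius] involves 4 r;
    the squared bound in time matches the exponent alpha / 2. *)
Lemma holder_neighbour z w r r' : 0 <= r -> 0 <= r' ->
  small_radius z r -> small_radius w r' ->
  enorm (z.1 - w.1) <= 2 * r + 2 * r' ->
  `|z.2 - w.2| <= (2 * r + 2 * r') ^+ 2 ->
  `|b z - b w| <= 2 * kappa * (D z + D w).
Proof.
move=> r0 r'0 /smallD zr /smallD wr' zwx zwt.
apply: le_trans (b_holder z w) _.
pose rho := 2 * r + 2 * r'; have rho0 : 0 <= rho by rewrite addr_ge0 ?mulr_ge0.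
have hx : enorm (z.1 - w.1) `^ alpha <= rho `^ alpha.
  by apply: ge0_ler_powR; rewrite ?nnegrE ?enorm_ge0 ?(ltW alpha0).
have ht : `|z.2 - w.2| `^ (alpha / 2) <= rho `^ alpha.
  have -> : rho `^ alpha = (rho ^+ 2) `^ (alpha / 2).
    by rewrite -powR_mulrn// -powRrM mulrC divfK.
  by apply: ge0_ler_powR; rewrite ?nnegrE ?exprn_ge0 ?divr_ge0 ?(ltW alpha0).
have hrho : rho `^ alpha <= (4 * r) `^ alpha + (4 * r') `^ alpha.
  have mono u : 0 <= u -> rho <= u -> rho `^ alpha <= u `^ alpha.
    by move=> u0 ru; apply: ge0_ler_powR; rewrite ?nnegrE ?(ltW alpha0).
  have [rr|/ltW rr] := leP r r'.
    apply: ler_wpDl; first exact: powR_ge0.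
    by apply: mono; rewrite ?mulr_ge0 /rho//; lra.
  apply: ler_wpDr; first exact: powR_ge0.
  by apply: mono; rewrite ?mulr_ge0 /rho//; lra.
apply: (@le_trans _ _ (A * (2 * ((4 * r) `^ alpha + (4 * r') `^ alpha)))).
  by rewrite ler_pM2l//; lra.
by lra.
Qed.

Section neighbours.
Variables z w : spacetime R n.
Hypothesis bzw : `|b z - b w| <= 2 * kappa * (D z + D w).

(* If [lambda] is smaller at [w'], then [D] is larger there, and the oscillation
   of [b] costs at most [4 kappa P w'] in the equation defining [lambda]. *)
Let growth z' w' : l w' <= l z' -> `|b z' - b w'| <= 2 * kappa * (D z' + D w') ->
  Lam <= (1 + 4 * kappa) * P w' + b z' * Q w' /\
  b z' * Q z' - 4 * kappa * D w' * Q z' <= b w' * Q z'.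
Proof.
move=> wz bb; have Dzw := D_anti wz; have k0 := kappa0.
have kD : kappa * D z' <= kappa * D w' by rewrite ler_wpM2l.
have := ler_normlW bb; rewrite -normrN in bb; have := ler_normlW bb.
move=> h1 h2.
have b1 : b w' <= b z' + 4 * kappa * D w' by lra.
have b2 : b z' - 4 * kappa * D w' <= b w' by lra.
split; last by rewrite -mulrBl ler_pM2r.
rewrite -[leLHS](PE w') mulrDl mul1r -addrA lerD2l -[in leRHS](DQ w').
by rewrite mulrA -mulrDl ler_pM2r// addrC.
Qed.

(** If lambda is larger at [z], then b z Q w <= b z Q z; cancelling this term between the two
    equations leaves P z <= (1 + 4 kappa) P w, and [K2] bounds the factor by K^2. *)
Lemma lambda_neighbour : P z <= K ^+ 2 * P w.
Proof.
have k0 := kappa0; have k2 := K2; have Pw := P0 w.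
have [zw|wz] := leP (l z) (l w).
  apply: le_trans (powR_mono (ltW p0) zw) _; rewrite ler_peMl ?ltW//; lra.
have [g _] := growth (ltW wz) bzw.
rewrite leNgt; apply/negP => lt; have bQ : b z * Q w <= b z * Q z.
  by rewrite ler_wpM2l// (powR_mono (ltW q0) (ltW wz)).
have kP : (2 + 200 * kappa) * P w <= K ^+ 2 * P w by rewrite ler_pM2r.
have kw : 0 <= kappa * P w by rewrite mulr_ge0// ltW.
have := PE z; lra.
Qed.

(** [powR_ratio] contraposed: since p < q, a ratio above 2 for [P] persists for [Q]. *)
Let Q_ratio z' w' : 2 * P w' < P z' -> 2 * Q w' < Q z'.
Proof.
move=> h; rewrite ltNge; apply/negP => Qzw; move: h; rewrite ltNge => /negP; apply.
by apply: (powR_ratio (p := q)) => //; rewrite ?ler1n// ltW//= ltW.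
Qed.

(** In the G phase b z Q z exceeds K^2 P z and so outweighs the multiples of kappa P that the
    oscillation of [b] produces. If [P] changed by more than the factor 2, so would [Q], and the
    q-terms would differ too much for both sums to equal [Lam]. *)
Lemma lambda_neighbourG : ~~ isQ z -> P z <= 2 * P w /\ P w <= 2 * P z.
Proof.
rewrite /p_phase -ltNge => G.
have k0 := kappa0; have k2 := K2; have Pw := P0 w; have Pz := P0 z.
have [zw|wz] := leP (l z) (l w).
  have Pzw := powR_mono (ltW p0) zw; split; first by lra.
  rewrite leNgt; apply/negP => lt; have Qzw := Q_ratio lt.
  have bwz : `|b w - b z| <= 2 * kappa * (D w + D z).
    by rewrite distrC [D w + _]addrC.
  have [g _] := growth zw bwz.
  have Dwz := D_anti zw.
  have b2 : b z - 4 * kappa * D z <= b w.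
    have kD : kappa * D w <= kappa * D z by rewrite ler_wpM2l.
    by have := ler_normlW bzw; lra.
  have b3 : b z * Q z - 4 * kappa * P z <= b w * Q z.
    by rewrite -[P z]DQ mulrA -mulrBl ler_pM2r.
  have b4 : b w * (2 * Q z) <= b w * Q w by rewrite ler_wpM2l// ltW.
  have kP : (2 + 200 * kappa) * P z <= K ^+ 2 * P z by rewrite ler_pM2r.
  have kw : 0 <= kappa * P z by rewrite mulr_ge0// ltW.
  have := PE w; lra.
have Pzw := powR_mono (ltW p0) (ltW wz).
split; last by lra.
rewrite leNgt; apply/negP => lt; have Qzw := Q_ratio lt.
have [g _] := growth (ltW wz) bzw.
have b4 : b z * (2 * Q w) <= b z * Q z by rewrite ler_wpM2l// ltW.
have kP : (2 + 200 * kappa) * P w <= K ^+ 2 * P w by rewrite ler_pM2r.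
have kPz : K ^+ 2 * (2 * P w) < K ^+ 2 * P z.
  by rewrite ltr_pM2l//; lra.
have kw : 0 <= kappa * P w by rewrite mulr_ge0// ltW.
have := PE z; lra.
Qed.

End neighbours.

(** In the p phase at [z] the factor K^2 of [lambda_neighbour] suffices. In the G phase [Lam] is at
    most (1 + K^2) lambda_w^2 times the weight at [w], whatever the phase of [w], and lambda_w^2 <=
    2 lambda_z^2; finally 2 (1 + K^2) <= (2 K)^2. *)
Lemma scale_neighbour z w :
  `|b z - b w| <= 2 * kappa * (D z + D w) ->
  intrinsic_scale z <= (2 * K) ^+ 2 * intrinsic_scale w.
Proof.
move=> bzw; have bwz : `|b w - b z| <= 2 * kappa * (D w + D z).
  by rewrite distrC [D w + _]addrC.
have k0 := kappa0; have k2 := K2; have Ple := lambda_neighbour bzw.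
have Kge2 : 2 <= K ^+ 2 by lra.
have e4 : (2 * K) ^+ 2 = 4 * K ^+ 2 by ring.
have sp c : 1 <= c -> P z <= c * P w -> l z `^ (p - 2) <= c * l w `^ (p - 2).
  move=> c1; apply: powR_ratio => //; apply/andP; split; last by rewrite gerBl.
  by rewrite subr_ge0.
have s2 c x y : 1 <= c -> P x <= c * P y -> l x ^+ 2 <= c * l y ^+ 2.
  move=> c1; rewrite -!powR_mulrn ?(ltW (l0 _))//; apply: powR_ratio => //.
  by rewrite ler0n p2.
have [Qz|Gz] := boolP (isQ z); last first.
  have [P1 P2] := lambda_neighbourG bzw Gz.
  rewrite {1}/intrinsic_scale (negbTE Gz) ler_pdivrMr ?exprn_gt0//.
  have lwz := s2 _ _ _ (ler1n _ 2) P2.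
  have swL : Lam <= (1 + K ^+ 2) * (intrinsic_scale w * l w ^+ 2).
    rewrite /intrinsic_scale; case: ifPn => [|_].
      rewrite /p_phase => Qw.
      have -> : l w `^ (p - 2) * l w ^+ 2 = P w.
        by rewrite -powR_mulrn ?(ltW (l0 _))// -powRD ?subrK// (gt_eqF (l0 w)) implybT.
      by rewrite -[leLHS](PE w) mulrDl mul1r lerD2l.
    rewrite divfK ?gt_eqF ?exprn_gt0// mulrDl mul1r lerDl mulr_ge0 ?sqr_ge0//.
    exact: ltW (lt_trans ltr01 Lam1).
  have sw0 := scale_gt0 w.
  apply: (le_trans swL); apply: (@le_trans _ _ ((1 + K ^+ 2) *
      (intrinsic_scale w * (2 * l z ^+ 2)))).
    by rewrite ler_pM2l ?ler_pM2l//; lra.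
  have -> : (1 + K ^+ 2) * (intrinsic_scale w * (2 * l z ^+ 2)) =
      (2 * (1 + K ^+ 2)) * (intrinsic_scale w * l z ^+ 2) by ring.
  by rewrite -[leRHS]mulrA ler_pM2r ?mulr_gt0 ?exprn_gt0//; lra.
rewrite {1}/intrinsic_scale Qz.
apply: (@le_trans _ _ ((2 * K) ^+ 2 * l w `^ (p - 2))).
  apply: sp; first by lra.
  by apply: (le_trans Ple); rewrite ler_pM2r//; lra.
by rewrite ler_pM2l ?scale_ge//; lra.
Qed.

Lemma lambda_ratio c s z w : 0 <= c -> P z <= c `^ s * P w ->
  l z <= c `^ (s / p) * l w.
Proof. by move=> c0; apply: powR_root_le. Qed.

End intrinsic_lambda.

(** Chebyshev's inequality for an arbitrary nonnegative [g]: its integral is a supremum over simple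
    functions below it, and [c] times the indicator of [Q] is one of them. *)
Lemma superlevel_le_integral {d} {T : measurableType d} {R : realType}
    (mu : {measure set T -> \bar R}) (g : T -> \bar R) (Q : set T) (c : R) :
  0 <= c -> measurable Q -> (forall x, 0 <= g x)%E ->
  (forall x, Q x -> c%:E <= g x)%E ->
  (c%:E * mu Q <= \int[mu]_x g x)%E.
Proof.
move=> c0 mQ g0 cg; rewrite ge0_integralTE//; apply: ereal_sup_ubound => /=.
exists (scale_nnsfun (indic_nnsfun R mQ) c0); last first.
  by rewrite sintegralrM sintegral_indic.
move=> x; rewrite [leLHS](_ : _ = (c * \1_Q x)%:E)// indicE; have [/set_mem Qx|_] := boolP (x \in Q).
  by rewrite mulr1; exact: cg.
by rewrite mulr0.
Qed.

(** * Superlevel sets of the strong maximal function *)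

Section maximal_function.
Context {R : realType} {n : nat}.
Implicit Types z w : spacetime R n.

(** A cylinder whose average exceeds [y] competes in the supremum at each of its points, so all of
    it lies in the superlevel set. *)
Lemma strong_maximal_superlevel (g : spacetime R n -> R) (y : \bar R) z :
  ~ (strong_maximal g z <= y)%E ->
  exists w r s, [/\ 0 < r, 0 < s, cylinder w r s z &
    forall z', cylinder w r s z' -> ~ (strong_maximal g z' <= y)%E].
Proof.
move=> /negP; rewrite -ltNge => /ereal_sup_gt[_ [Q [w [r [s [r0 s0 -> Qz]]]] <-]] yQ.
exists w, r, s; split => // z' Qz'; apply/negP; rewrite -ltNge.
apply: lt_le_trans yQ _; apply: ereal_sup_ubound; exists (cylinder w r s) => //.
by exists w, r, s.
Qed.

Lemma cylinder_inner (w z : spacetime R n) (r s : R) : cylinder w r s z ->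
  exists2 rho, 0 < rho & forall z', enorm (z'.1 - z.1) < rho ->
    `|z'.2 - z.2| < rho -> cylinder w r s z'.
Proof.
rewrite /cylinder /eball /= in_itv/= -ltr_distl => -[zx zt].
exists (Num.min (r - enorm (z.1 - w.1)) (s - `|z.2 - w.2|)).
  by rewrite lt_min !subr_gt0 zx.
move=> z'; rewrite !lt_min => /andP[x1 _] /andP[_ t1]; split => /=.
  by have := enorm_triangle z'.1 z.1 w.1; lra.
by rewrite in_itv/= -ltr_distl; have := ler_distD z.2 z'.2 w.2; lra.
Qed.

End maximal_function.

(** * Sign, upper bound and modulus of continuity of the extended coefficient *)

Section holder_extension.
Context {R : realType} {n : nat}.
Variables (Omega : set 'rV[R]_n) (T alpha A : R) (a : spacetime R n -> R).
Implicit Types z w v : spacetime R n.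
Hypotheses (alpha0 : 0 < alpha) (alpha1 : alpha <= 1) (A0 : 0 < A).
Hypothesis a0 : forall z, space_time_cylinder Omega T z -> 0 <= a z.

Local Notation OmegaT := (space_time_cylinder Omega T).
Local Notation b := (holder_extension Omega T alpha A a).

Let gauge z w := A * (enorm (z.1 - w.1) `^ alpha + `|z.2 - w.2| `^ (alpha / 2)).

Let gauge_ge0 z w : 0 <= gauge z w.
Proof. by rewrite mulr_ge0 ?(ltW A0)// addr_ge0 ?powR_ge0. Qed.

Let gauge_triangle z w v : gauge z v <= gauge w v + gauge z w.
Proof.
rewrite -mulrDr ler_pM2l// addrACA lerD//.
  rewrite addrC; apply: le_trans (powR_subadd _ _ alpha0 alpha1); rewrite ?enorm_ge0//.
  by apply: ge0_ler_powR; rewrite ?nnegrE ?addr_ge0 ?enorm_ge0 ?(ltW alpha0)// enorm_triangle.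
rewrite addrC; apply: le_trans (powR_subadd _ _ _ _); rewrite ?normr_ge0//.
- apply: ge0_ler_powR; rewrite ?nnegrE ?addr_ge0 ?divr_ge0 ?(ltW alpha0)//.
  exact: ler_distD.
- by rewrite divr_gt0.
- by have := alpha1; lra.
Qed.

Let values z := [set a w + gauge z w | w in OmegaT].

Let values_ge0 z y : values z y -> 0 <= y.
Proof. by move=> [w Ow <-]; rewrite addr_ge0// a0. Qed.

Lemma Linfty_norm_ge0 : 0 <= Linfty_norm OmegaT a.
Proof. by rewrite fine_ge0// Lnorm_ge0. Qed.

Lemma holder_extension_ge0 z : 0 <= b z.
Proof.
rewrite /holder_extension le_min Linfty_norm_ge0 andbT.
have [[y ay]|/set0P/negP] := pselect (values z !=set0).
  by apply: lb_le_inf; [exists y|exact: values_ge0].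
(* If the space-time cylinder is empty, the infimum has its default value 0. *)
by rewrite negbK => /eqP e; rewrite [X in inf X]e inf0.
Qed.

Lemma holder_extension_le z : b z <= Linfty_norm OmegaT a.
Proof. by rewrite /holder_extension ge_min lexx orbT. Qed.

(** Both exponents are at most 1, so the gauge obeys the triangle inequality and each competitor
    changes by at most the gauge between the base points. *)
Let inf_values_le z w : inf (values z) <= inf (values w) + gauge z w.
Proof.
have [[v Ov]|nO] := pselect (OmegaT !=set0); last first.
  have e z' : values z' = set0.
    by apply/seteqP; split => // y [v Ov _]; apply: nO; exists v.
  by rewrite !e inf0 add0r.
rewrite -lerBlDr; apply: lb_le_inf; first by exists (a v + gauge w v), v.
move=> _ [u Ou <-]; rewrite lerBlDr.
apply: (@le_trans _ _ (a u + gauge z u)).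
  by apply: ge_inf; [exists 0 => y; exact: values_ge0|exists u].
by rewrite -addrA lerD2l gauge_triangle.
Qed.

(** Taking the minimum with a constant is 1-Lipschitz, so the two bounds of [inf_values_le] survive
    the truncation. *)
Lemma holder_extension_holder z w : `|b z - b w| <=
  A * (enorm (z.1 - w.1) `^ alpha + `|z.2 - w.2| `^ (alpha / 2)).
Proof.
have bE z' : b z' = Num.min (inf (values z')) (Linfty_norm OmegaT a) by [].
rewrite -/(gauge z w) !bE.
have zw := inf_values_le z w; have wz := inf_values_le w z.
have gC : gauge w z = gauge z w by rewrite /gauge enormBC distrC.
rewrite gC in wz; have g0 := gauge_ge0 z w.
move: (inf (values z)) (inf (values w)) (Linfty_norm _ _) (gauge z w) zw wz g0.
move=> x y c g xy yx g0; rewrite ler_distl.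
by have [xc|cx] := leP x c; have [yc|cy] := leP y c; apply/andP; split; lra.
Qed.

End holder_extension.

(** * The partition of unity *)

Lemma sum_finite_support_le {R : realType} (a : nat -> R) (c : R) (I : set nat) j :
  finite_set I -> 0 <= c -> (forall k, ~ I k -> a k = 0) ->
  (forall k, I k -> a k <= c) ->
  \sum_(k < j) a k <= #|` fset_set I|%fset%:R * c.
Proof.
move=> finI c0 a0 ac; rewrite -(big_mkord xpredT) /index_iota subn0.
rewrite (bigID (mem I))/= [X in _ + X]big1 ?addr0; last first.
  by move=> k kI; apply: a0 => Ik; move: kI; rewrite mem_set.
rewrite -big_filter; set s := [seq _ <- _ | _].
have us : uniq s by rewrite filter_uniq// iota_uniq.
apply: (@le_trans _ _ (\sum_(k <- s) c)).
  rewrite big_seq [leRHS]big_seq; apply: ler_sum => k.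
  by rewrite mem_filter => /andP[/set_mem/ac].
rewrite big_const_seq count_predT iter_addr addr0 mulr_natl ler_wpMn2l//.
apply: uniq_leq_size => // k; rewrite mem_filter => /andP[kI _].
by rewrite in_fset_set.
Qed.

Section partition_of_unity.
Context {R : realType} {n : nat}.
Variables (E : set (spacetime R n)) (sigma : spacetime R n -> R) (K : R).
Variable Z : nat -> spacetime R n.
Implicit Types (z : spacetime R n) (i j k : nat).

Hypothesis E_neq0 : E !=set0.
Hypothesis E_closed : forall z, ~ E z -> exists2 rho, 0 < rho &
  forall w, enorm (w.1 - z.1) < rho -> `|w.2 - z.2| < rho -> ~ E w.
Hypothesis sigma_gt0 : forall z, ~ E z -> 0 < sigma z.
Hypothesis K_ge1 : 1 <= K.
Local Notation ball := (wball E sigma).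
Hypothesis sigma_comparable : forall z w, ~ E z -> ~ E w ->
  ball 2 z `&` ball 2 w !=set0 -> sigma z <= (2 * K) ^+ 2 * sigma w.
Hypothesis nEZ : forall i, ~ E (Z i).
Hypothesis coverZ : \bigcup_i ball 1 (Z i) = ~` E.
Hypothesis disjointZ : forall i j, i <> j ->
  ball (6 * K)^-1 (Z i) `&` ball (6 * K)^-1 (Z j) = set0.

Local Notation r i := (wradius E sigma (Z i)).
Local Notation s i := (sigma (Z i)).
Local Notation meeting i := [set j | ball 2 (Z i) `&` ball 2 (Z j) !=set0].

Let r0 i : 0 < r i.
Proof. exact: (wradius_gt0 E_neq0 E_closed sigma_gt0 (@nEZ i)). Qed.

Let s0 i : 0 < s i. Proof. exact: sigma_gt0 (@nEZ i). Qed.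

Let psi i := bump (Z i) (r i) (s i).

Definition whitney_partition i : spacetime R n -> R := picked psi i.

Let spsi i : smooth_expr (psi i). Proof. exact: smooth_bump. Qed.
Let psi_ge0 i z : 0 <= psi i z. Proof. exact: bump_ge0. Qed.
Let psi_le1 i z : psi i z <= 1. Proof. exact: bump_le1. Qed.

Lemma whitney_partition_bounds i z :
  0 <= whitney_partition i z /\ whitney_partition i z <= 1.
Proof. by split; [exact: picked_ge0|exact: picked_le1]. Qed.

Let ball2 i z : enorm (z.1 - (Z i).1) < 2 * r i ->
  s i * `|z.2 - (Z i).2| < 2 * r i ^+ 2 -> ball 2 (Z i) z.
Proof.
move=> zx zt; have ri := r0 i.
have r2 : 0 < 2 * r i by rewrite mulr_gt0.
rewrite /wball /wdist/= para_dist_lt ?(ltW (s0 i))//.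
rewrite enormBC zx distrC (lt_trans zt)//.
have -> : (2 * r i) ^+ 2 = 4 * r i ^+ 2 by ring.
by rewrite ltr_pM2r ?exprn_gt0// ltr_nat.
Qed.

Lemma whitney_partition_test i : test_function (ball 2 (Z i)) (whitney_partition i).
Proof.
apply: (bump_test_function (z0 := Z i) (r0 i) (s0 i)).
- exact: smooth_picked.
- by move=> z; rewrite /whitney_partition /picked mulf_eq0 negb_or => /andP[].
- exact: ball2.
Qed.

Lemma whitney_partition_sum z : ~ E z ->
  series (fun i => whitney_partition i z) @ \oo --> (1 : R).
Proof.
rewrite -[~ E z]/((~` E) z) -coverZ => -[i _ iz]; apply: series_picked; exists i.
move: iz; rewrite /wball /wdist/= mul1r para_dist_lt ?(ltW (s0 i))// => /andP[zx zt].
by apply: bump1; rewrite // 1?enormBC// distrC.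
Qed.

Local Notation N := (packing_number (n := n) K : R).

(** Where [psi j] is nonzero, the bumps with nonzero derivative belong to neighbours of [j]; there
    are at most [N] of them, each contributing at most [m * B j]. *)
Let derive_partition (v : spacetime R n) (B : nat -> R) (m : R) j z :
  0 <= m -> (forall k, 0 <= B k) ->
  (forall k z, `|'D_v (psi k) z| <= B k) ->
  (forall k, meeting j k -> B k <= m * B j) ->
  `|'D_v (whitney_partition j) z| <= (1 + m * N) * B j.
Proof.
move=> m0 B0 dB mB.
apply: le_trans (derive_picked spsi psi_ge0 psi_le1 j v z) _.
rewrite mulrDl mul1r lerD//.
have [fin card] := finite_meeting E_neq0 E_closed sigma_gt0 K_ge1 sigma_comparable
  nEZ disjointZ j.
have mBj : 0 <= m * B j by rewrite mulr_ge0.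
have Nm : m * N * B j = N * (m * B j) by ring.
have N0 : 0 <= N by exact: le_trans card.
have [->|pj] := eqVneq (psi j z) 0; first by rewrite mul0r Nm mulr_ge0.
have jz : ball 2 (Z j) z.
  by have [] := bump_supportP (r0 j) (s0 j) (or_introl pj); exact: ball2.
apply: (@le_trans _ _ (\sum_(k < j) `|'D_v (psi k) z|)).
  by rewrite ler_piMl//; apply: sumr_ge0.
rewrite Nm; apply: le_trans (ler_wpM2r mBj card).
apply: (sum_finite_support_le (a := fun k => `|'D_v (psi k) z|)) => //.
- move=> k nk; apply/eqP; rewrite normr_eq0; apply/negPn/negP => dk; apply: nk.
  exists z; split => //.
  have [] := bump_supportP (r0 k) (s0 k) (or_intror (ex_intro _ v dk)); exact: ball2.
- by move=> k /mB; exact: le_trans.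
Qed.

Let r_compare j k : meeting j k -> (r k)^-1 <= 6 * K * (r j)^-1.
Proof.
move=> jk; have K1 := K_ge1.
have := wradius_neighbour E_neq0 sigma_gt0 K_ge1 sigma_comparable
  (@nEZ j) (@nEZ k) jk.
have rj := r0 j; have rk := r0 k => rjk.
by rewrite -[leLHS]mul1r ler_pdivrMr// mulrAC ler_pdivlMr// mul1r.
Qed.

Let meetingC i j : meeting i j -> meeting j i.
Proof. by rewrite /= setIC. Qed.

(** [n%:R] passes from coordinates to the norm, [1 + 6 * K * N] comes from the product of bumps, the
    outer [6 * K] from replacing the radius of [j] by that of [i], and [4 * cutoff_slope] from a
    single bump. *)
Definition gradient_const : R :=
  n%:R * ((1 + 6 * K * N) * (6 * K * (4 * cutoff_slope))).

Lemma whitney_partition_gradient i j z : meeting i j ->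
  enorm (gradient_x (whitney_partition j) z) <= gradient_const * (r i)^-1.
Proof.
move=> ij; have K1 := K_ge1; have K6 : 0 <= 6 * K by lra.
have S0 := @cutoff_slope_ge0 R.
have [_ /(le_trans (ler0n _ _)) N0] := finite_meeting E_neq0 E_closed sigma_gt0
  K_ge1 sigma_comparable nEZ disjointZ i.
pose B k := 4 * cutoff_slope * (r k)^-1 : R.
have B0 k : 0 <= B k by rewrite mulr_ge0 ?mulr_ge0// invr_ge0 ltW.
have B_compare i' j' : meeting i' j' -> B j' <= 6 * K * B i'.
  by move=> /r_compare h; rewrite mulrCA ler_wpM2l// mulr_ge0.
rewrite /gradient_const -mulrA; apply: enorm_le => [|e].
  apply: mulr_ge0; last by rewrite invr_ge0 ltW.
  apply: mulr_ge0; first by rewrite addr_ge0// mulr_ge0.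
  by apply: mulr_ge0 => //; exact: mulr_ge0.
rewrite /gradient_x mxE.
have d := derive_partition (v := (delta_mx 0 e, 0)) z K6 B0
  (fun k z => derive_bump_space (Z k) (r0 k) (s0 k) e z) (fun k => @B_compare j k).
apply: (le_trans d); rewrite -[leRHS]mulrA.
apply: ler_wpM2l; first by rewrite addr_ge0// mulr_ge0.
by rewrite -[leRHS]mulrA; exact: B_compare.
Qed.

Let scale_compare j k : meeting j k ->
  s k / r k ^+ 2 <= (2 * K) ^+ 2 * (6 * K) ^+ 2 * (s j / r j ^+ 2).
Proof.
move=> jk; have K1 := K_ge1; have K6 : 0 <= 6 * K by lra.
rewrite mulrACA -!exprVn -exprMn; apply: ler_pM.
- exact: ltW.
- by rewrite exprn_ge0// invr_ge0 ltW.
- by apply: sigma_comparable => //; exact: meetingC.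
- have rk : 0 <= (r k)^-1 by rewrite invr_ge0 ltW.
  have rjk := r_compare jk.
  by apply: lerXn2r => //; rewrite nnegrE (le_trans rk).
Qed.

(** Built like [gradient_const], with (2 K)^2 (6 K)^2 bounding the ratio of sigma / r^2 between
    neighbours. *)
Definition time_const : R := (1 + (2 * K) ^+ 2 * (6 * K) ^+ 2 * N) *
  ((2 * K) ^+ 2 * (6 * K) ^+ 2 * (4 * cutoff_slope)).

Lemma whitney_partition_time i j z : meeting i j ->
  `|partial_t (whitney_partition j) z| <= time_const * (s i / r i ^+ 2).
Proof.
move=> ij; have K1 := K_ge1.
pose m := (2 * K) ^+ 2 * (6 * K) ^+ 2.
have m0 : 0 <= m by rewrite mulr_ge0 ?sqr_ge0.
have S0 := @cutoff_slope_ge0 R.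
have [_ /(le_trans (ler0n _ _)) N0] := finite_meeting E_neq0 E_closed sigma_gt0
  K_ge1 sigma_comparable nEZ disjointZ i.
pose B k := 4 * cutoff_slope * (s k / r k ^+ 2) : R.
have B0 k : 0 <= B k.
  by rewrite mulr_ge0 ?mulr_ge0// ?(ltW (s0 k))// invr_ge0 exprn_ge0// ltW.
have B_compare i' j' : meeting i' j' -> B j' <= m * B i'.
  by move=> /scale_compare h; rewrite mulrCA ler_wpM2l// mulr_ge0.
have d := derive_partition (v := (0, 1)) z m0 B0
  (fun k z => derive_bump_time (Z k) (r0 k) (s0 k) z) (fun k => @B_compare j k).
apply: (le_trans d); rewrite /time_const -/m -[leRHS]mulrA.
apply: ler_wpM2l; first by rewrite addr_ge0// mulr_ge0.
by rewrite -[leRHS]mulrA; exact: B_compare.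
Qed.

End partition_of_unity.

(** * The Whitney decomposition *)

Lemma Linfty_le {d} {T : measurableType d} {R : realType}
    (mu : {measure set T -> \bar R}) (F : T -> R) (c : R) :
  0 <= c -> (forall x, `|F x| <= c) -> ('N[mu]_+oo[EFin \o F] <= c%:E)%E.
Proof.
move=> c0 Fc; rewrite unlock /=; case: ifPn => // _.
by apply/ess_supP/nearW => x /=; rewrite lee_fin.
Qed.

Section intrinsic_whitney.
Context {R : realType} {n : nat}.
Variables (p q alpha A Lam me K : R) (b : spacetime R n -> R).
Variable E : set (spacetime R n).
Implicit Types z w : spacetime R n.
Hypotheses (p2 : 2 <= p) (pq : p < q) (alpha0 : 0 < alpha) (alpha1 : alpha <= 1).
Hypothesis q_le : q <= p + 2 * alpha / (n%:R + 2).
Hypothesis A0 : 0 < A.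
Hypothesis b0 : forall z, 0 <= b z.
Hypothesis b_lt : forall z, 1 + b z < Lam.
Hypothesis b_holder : forall z w, `|b z - b w| <=
  A * (enorm (z.1 - w.1) `^ alpha + `|z.2 - w.2| `^ (alpha / 2)).
Hypothesis E_closed : forall z, ~ E z -> exists2 rho, 0 < rho &
  forall w, enorm (w.1 - z.1) < rho -> `|w.2 - z.2| < rho -> ~ E w.
Local Notation ubv := (unit_ball_volume (R := R) (n := n)).
Hypothesis cylinder_le : forall z r s, 0 < r -> 0 < s ->
  cylinder z r s `<=` ~` E -> Lam * (ubv * r ^+ n * (2 * s)) <= me.
Hypothesis KE : K = Num.sqrt 2 + 800 * A * (ubv^-1 * me) `^ (alpha / (n%:R + 2)).

Local Notation l := (lambda p q Lam b).
Local Notation scale := (intrinsic_scale p q Lam K b).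
Local Notation rad := (whitney_radius p q Lam K b E).
Local Notation ball := (wball E scale).

Let kappa := A * (ubv^-1 * me) `^ (alpha / (n%:R + 2)).

Let kappa0 : 0 <= kappa.
Proof. by rewrite mulr_ge0 ?powR_ge0// ltW. Qed.

Let K_ge : Num.sqrt 2 + 200 * kappa <= K.
Proof.
rewrite KE lerD2l -mulrA; apply: ler_wpM2r; first exact: kappa0.
by rewrite ler_nat.
Qed.

Let Lam1 : 1 < Lam.
Proof. by have := b_lt 0; have := b0 0; lra. Qed.

Let Lam0 : 0 < Lam. Proof. exact: lt_trans Lam1. Qed.

(** If [E] were empty, arbitrarily large cylinders would obey the volume bound. *)
Lemma exceptional_set_neq0 : E !=set0.
Proof.
apply: contrapT => nE; have ubv0 := unit_ball_volume_gt0 (R := R) n.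
(* Makes [Lam * ubv * r] exceed the absolute value of [me], while [r >= 1] keeps [r ^+ n] at least
   1. *)
pose r := 1 + `|me| / (Lam * ubv); have r1 : 1 <= r.
  by rewrite lerDl divr_ge0// mulr_ge0// ltW.
have r0 : 0 < r by exact: lt_le_trans r1.
have h := @cylinder_le 0 r r r0 r0 (fun z _ Ez => nE (ex_intro _ z Ez)).
have meL : `|me| < Lam * ubv * r.
  rewrite /r mulrDr mulr1 mulrCA divff ?mulr1 ?ltrDr ?mulr_gt0//.
  by rewrite gt_eqF// mulr_gt0.
have rn : 1 <= r ^+ n by exact: exprn_ege1.
have : Lam * ubv * r * 1 <= Lam * ubv * r * r ^+ n by rewrite ler_wpM2l// !mulr_ge0 ?ltW.
have e : Lam * (ubv * r ^+ n * (2 * r)) = 2 * (Lam * ubv * r * r ^+ n) by ring.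
rewrite {}e in h.
have := normr_ge0 me; have := ler_norm me; lra.
Qed.

Let E_neq0 := exceptional_set_neq0.

Let scale0 z : ~ E z -> 0 < scale z.
Proof. by move=> _; exact: (scale_gt0 q K p2 b0 b_lt). Qed.

Let rad0 z : ~ E z -> 0 < rad z.
Proof. exact: (wradius_gt0 E_neq0 E_closed scale0). Qed.

Let l1 z : 1 < l z. Proof. exact: (lambdaP q p2 b0 b_lt z).1. Qed.
Let l0 z : 0 < l z. Proof. exact: lt_trans (l1 z). Qed.

Lemma Ucyl_ball c z : ~ E z -> 0 < c -> Ucyl p q Lam K b E c z = ball c z.
Proof.
move=> nEz c0; have cr : 0 < c * rad z by rewrite mulr_gt0// rad0.
have -> : ball c z = cylinder z (c * rad z) ((scale z)^-1 * (c * rad z) ^+ 2).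
  by apply/funext => w; rewrite cylinder_para_dist// scale0.
rewrite /Ucyl /Qlambda /Glambda /intrinsic_scale; case: ifPn => _.
  by rewrite -powRN opprB.
by rewrite invfM invrK [Lam^-1 * _]mulrC.
Qed.

(** The volume of 4 U_z is of order (4 r)^(n+2) divided by the time weight, which is at most Lam /
    lambda^2 in both phases; so [cylinder_le] gives (4 r)^(n+2) lambda^2 <= me / |B_1|. The power
    alpha / (n + 2) of this contains lambda^(2 alpha / (n+2)), which dominates lambda^(q-p) by the
    gap condition and lambda > 1. *)
Let small z : ~ E z -> small_radius p q alpha A Lam kappa b z (rad z).
Proof.
move=> nEz; have r0 := rad0 nEz; have s0 := scale0 nEz.
have ubv0 := unit_ball_volume_gt0 (R := R) n.
have r4 : 0 < 4 * rad z by rewrite mulr_gt0.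
have sub : cylinder z (4 * rad z) ((scale z)^-1 * (4 * rad z) ^+ 2) `<=` ~` E.
  move=> w; rewrite cylinder_para_dist// => zw.
  exact: (wball4_sub E_neq0 nEz zw).
have vol := cylinder_le r4 (mulr_gt0 (_ : 0 < (scale z)^-1) (exprn_gt0 2 r4)) sub.
have {}vol : (4 * rad z) ^+ n.+2 * l z ^+ 2 <= ubv^-1 * me.
  rewrite ler_pdivlMl//; apply: le_trans (vol _); last by rewrite invr_gt0.
  have sl : l z ^+ 2 <= Lam / scale z.
    rewrite ler_pdivlMr// mulrC -ler_pdivlMr ?exprn_gt0//.
    exact: (scale_le q K p2 b0 b_lt).
  apply: (@le_trans _ _ (ubv * ((4 * rad z) ^+ n.+2 * (Lam / scale z)))).
    by rewrite ler_pM2l// ler_pM2l// exprn_gt0.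
  have -> : Lam * (ubv * (4 * rad z) ^+ n * (2 * ((scale z)^-1 * (4 * rad z) ^+ 2))) =
      2 * (ubv * ((4 * rad z) ^+ n.+2 * (Lam / scale z))).
    by rewrite !exprS expr0; ring.
  have : 0 <= ubv * ((4 * rad z) ^+ n.+2 * (Lam / scale z)).
    by rewrite mulr_ge0 ?(ltW ubv0)// mulr_ge0 ?exprn_ge0 ?divr_ge0 ?ltW.
  by lra.
have n2 : 0 < n%:R + 2 :> R by rewrite ltr_wpDl.
have al0 : 0 <= alpha / (n%:R + 2) by rewrite divr_ge0 ?ltW.
have ra : (4 * rad z) `^ alpha = ((4 * rad z) ^+ n.+2) `^ (alpha / (n%:R + 2)).
  rewrite -powR_mulrn ?(ltW r4)// -powRrM; congr (_ `^ _).
  by rewrite -addn2 natrD mulrC divfK// gt_eqF.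
have rl : (4 * rad z) `^ alpha * (l z ^+ 2) `^ (alpha / (n%:R + 2)) <=
    (ubv^-1 * me) `^ (alpha / (n%:R + 2)).
  have r4n : 0 <= (4 * rad z) ^+ n.+2 by rewrite exprn_ge0// ltW.
  have l2 : 0 <= l z ^+ 2 by exact: sqr_ge0.
  rewrite ra -powRM//; apply: ge0_ler_powR => //.
    by rewrite nnegrE mulr_ge0.
  by rewrite nnegrE (le_trans _ vol)// mulr_ge0.
have lq : l z `^ q <= (l z ^+ 2) `^ (alpha / (n%:R + 2)) * l z `^ p.
  rewrite -powR_mulrn ?(ltW (l0 z))// -powRrM -powRD; last first.
    by rewrite (gt_eqF (l0 z)) implybT.
  by apply: ler_powR; [exact: ltW|move: q_le; rewrite mulrA addrC].
rewrite /small_radius /kappa.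
apply: (@le_trans _ _ (A * (4 * rad z) `^ alpha *
    ((l z ^+ 2) `^ (alpha / (n%:R + 2)) * l z `^ p))).
  by rewrite ler_wpM2l// mulr_ge0 ?powR_ge0// ltW.
rewrite mulrA ler_pM2r ?powR_gt0// -mulrA ler_pM2l//.
Qed.

(** The time weight is at least 1, so intrinsic cylinders lie in standard parabolic ones, where
    [holder_neighbour] applies. *)
Let b_close z w : ~ E z -> ~ E w -> ball 2 z `&` ball 2 w !=set0 ->
  `|b z - b w| <= 2 * kappa * (l z `^ (p - q) + l w `^ (p - q)).
Proof.
move=> nEz nEw [y [yz yw]].
have rz := rad0 nEz; have rw := rad0 nEw.
have bound z' : ~ E z' -> ball 2 z' y ->
    enorm (z'.1 - y.1) < 2 * rad z' /\ `|z'.2 - y.2| < (2 * rad z') ^+ 2.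
  move=> nEz'; have r0 := rad0 nEz'; have s0 := scale0 nEz'.
  have r2 : 0 < 2 * rad z' by rewrite mulr_gt0.
  rewrite /wball /wdist /= para_dist_lt ?(ltW s0)// => /andP[yx yt]; split => //.
  apply: le_lt_trans yt; rewrite ler_peMl//.
  exact: (scale_ge1 q K p2 b0 b_lt).
have [zx zt] := bound _ nEz yz; have [wx wt] := bound _ nEw yw.
apply: (holder_neighbour p2 alpha0 A0 b0 b_lt b_holder (ltW rz) (ltW rw)
  (small nEz) (small nEw)).
  have := enorm_triangle z.1 y.1 w.1; rewrite [enorm (y.1 - _)]enormBC; lra.
have := ler_distD y.2 z.2 w.2; rewrite [X in _ <= _ + X]distrC.
have : 0 <= rad z * rad w by rewrite mulr_ge0// ltW.
have -> : (2 * rad z + 2 * rad w) ^+ 2 =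
  (2 * rad z) ^+ 2 + (2 * rad w) ^+ 2 + 8 * (rad z * rad w) by ring.
by lra.
Qed.

Let one_le_K : 1 <= K. Proof. exact: K_ge1 kappa0 K_ge. Qed.

Let scale_comparable z w : ~ E z -> ~ E w -> ball 2 z `&` ball 2 w !=set0 ->
  scale z <= (2 * K) ^+ 2 * scale w.
Proof.
by move=> nEz nEw /(b_close nEz nEw)/(scale_neighbour p2 pq b0 b_lt kappa0 K_ge).
Qed.

(** The radius is 50 K times 4 r, so the oscillation is at most 100 K h with h = A (4 r)^alpha. In
    the G phase [small] becomes K^2 h <= kappa b z, and 200 kappa <= K turns this into 200 K h <= b
    z: the oscillation is at most half of b z. *)
Let small_cylinder z w : ~ E z -> ~~ p_phase p q Lam K b z ->
  Qstd (200 * K * rad z) z w -> b z / 2 <= b w /\ b w <= 2 * b z.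
Proof.
move=> nEz; rewrite /p_phase -ltNge => G; have r0 := rad0 nEz; have K1 := one_le_K.
have K0 : 0 < K by lra.
have r4 : 0 < 4 * rad z by rewrite mulr_gt0.
have K50 : 1 <= 50 * K by lra.
rewrite /Qstd /cylinder /= => -[zx zt].
pose rho := 200 * K * rad z; have rhoE : rho = 50 * K * (4 * rad z) by rewrite /rho; ring.
have rho0 : 0 <= rho by rewrite rhoE mulr_ge0 ?(ltW r4)//; lra.
have wx : enorm (z.1 - w.1) `^ alpha <= rho `^ alpha.
  apply: ge0_ler_powR; rewrite ?nnegrE ?enorm_ge0 ?(ltW alpha0)//.
  by rewrite enormBC ltW.
have wt : `|z.2 - w.2| `^ (alpha / 2) <= rho `^ alpha.
  have -> : rho `^ alpha = (rho ^+ 2) `^ (alpha / 2).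
    by rewrite -powR_mulrn// -powRrM mulrC divfK.
  apply: ge0_ler_powR; rewrite ?nnegrE ?exprn_ge0 ?divr_ge0 ?(ltW alpha0)//.
  by move: zt; rewrite in_itv/= -ltr_distl distrC => /ltW.
have rhoa : rho `^ alpha <= 50 * K * (4 * rad z) `^ alpha.
  rewrite rhoE powRM ?(ltW r4)//; last by lra.
  by rewrite ler_wpM2r ?powR_ge0// ler1_powR.
have bw := b_holder z w.
pose h := A * (4 * rad z) `^ alpha.
have bh : `|b z - b w| <= 100 * (K * h).
  apply: (le_trans bw).
  apply: (@le_trans _ _ (A * (2 * (50 * K * (4 * rad z) `^ alpha)))).
    by rewrite ler_pM2l//; lra.
  by rewrite le_eqVlt; apply/orP; left; apply/eqP; rewrite /h; ring.
have Kh : K ^+ 2 * h <= kappa * b z.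
  rewrite -(@ler_pM2r _ (l z `^ q)) ?powR_gt0//.
  apply: (@le_trans _ _ (K ^+ 2 * (kappa * l z `^ p))).
    by rewrite -mulrA ler_wpM2l ?sqr_ge0//; exact: small.
  by rewrite mulrCA -[leRHS]mulrA ler_wpM2l// ltW.
have k200 : 200 * kappa <= K by apply: le_trans K_ge; rewrite lerDr sqrtr_ge0.
have Kb : K * (200 * (K * h)) <= K * b z.
  have -> : K * (200 * (K * h)) = 200 * (K ^+ 2 * h) by ring.
  apply: (@le_trans _ _ (200 * kappa * b z)).
    by rewrite -mulrA ler_wpM2l ?ler0n.
  by rewrite ler_wpM2r.
move: Kb; rewrite ler_pM2l// => Kb.
have e : 200 * (K * h) = 2 * (100 * (K * h)) by ring.
rewrite {}e in Kb; move: bh; rewrite ler_distlC => /andP[h1 h2].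
have := b0 z; move: (100 * (K * h)) Kb h1 h2 => u; lra.
Qed.

(** [kappa] contains the energy; the larger [K] in its place leaves a constant in [A] and [K]
    only. *)
Let radius_power z : ~ E z ->
  rad z `^ alpha * l z `^ q <= K / A * l z `^ p.
Proof.
move=> nEz; have r0 := rad0 nEz; have := small nEz; rewrite /small_radius => h.
have ra : rad z `^ alpha <= (4 * rad z) `^ alpha.
  have rr : rad z <= 4 * rad z by lra.
  by apply: ge0_ler_powR => //; rewrite ?nnegrE ?(ltW alpha0) ?(le_trans _ rr)// ltW.
have kK : kappa <= K.
  have := K_ge; have := kappa0; have : 0 <= Num.sqrt 2 :> R by exact: sqrtr_ge0.
  have -> : 200 * kappa = kappa + 199 * kappa by ring.
  have : 0 <= 199 * kappa by exact: mulr_ge0 (ler0n _ _) kappa0.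
  by move: (199 * kappa) => u; lra.
rewrite mulrAC ler_pdivlMr// mulrC mulrA.
apply: (@le_trans _ _ (kappa * l z `^ p)); last by rewrite ler_pM2r ?powR_gt0.
by apply: le_trans h; rewrite ler_pM2r ?powR_gt0// ler_pM2l.
Qed.

Let set_dist_bounds z : ~ E z ->
  3 * rad z <= intrinsic_set_dist p q Lam K b z (Ucyl p q Lam K b E 1 z) E /\
  intrinsic_set_dist p q Lam K b z (Ucyl p q Lam K b E 1 z) E <= 4 * rad z.
Proof.
move=> nEz; have [e Ee] := E_neq0; rewrite Ucyl_ball// /intrinsic_set_dist.
have zz : ball 1 z z by exact: (wball_self E_neq0 E_closed scale0).
have lb w1 w2 : ball 1 z w1 -> E w2 -> 3 * rad z <= para_dist (scale z) w1 w2.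
  move=> zw1 Ew2.
  have := para_dist_triangle z w1 w2 (ltW (scale0 nEz)).
  have : 4 * rad z <= para_dist (scale z) z w2.
    exact: (wradius_le scale E_neq0 z Ew2).
  have : para_dist (scale z) z w1 < 1 * rad z := zw1.
  lra.
split.
  apply: lb_le_inf; first by exists (para_dist (scale z) z e), z => //; exists e.
  by move=> _ [w1 zw1 [w2 Ew2 <-]]; exact: lb.
have -> : 4 * rad z = inf [set intrinsic_dist p q Lam K b z z w | w in E].
  by rewrite /whitney_radius mulrC divfK.
apply: lb_le_inf; first by exists (para_dist (scale z) z e), e.
move=> _ [w Ew <-]; apply: ge_inf; last by exists z => //; exists w.
by exists 0 => _ [w1 _ [w2 _ <-]]; exact: para_dist_ge0.
Qed.

Let lambda_compare z w : ~ E z -> ~ E w -> ball 2 z `&` ball 2 w !=set0 ->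
  l z <= K `^ (2 / p) * l w.
Proof.
move=> nEz nEw zw; have K0 : 0 <= K by have := one_le_K; lra.
apply: (lambda_ratio p2 b0 b_lt K0); rewrite powR_mulrn//.
exact: (lambda_neighbour p2 pq b0 b_lt kappa0 K_ge (b_close nEz nEw zw)).
Qed.

Let inv_powR_le c s z w : 0 < c -> l w <= c `^ s * l z -> c `^ (- s) * l w <= l z.
Proof. by move=> c0 h; rewrite powRN ler_pdivrMl// powR_gt0. Qed.

Local Notation isQ := (p_phase p q Lam K b).
Local Notation set_dist := (intrinsic_set_dist p q Lam K b).
Local Notation U := (Ucyl p q Lam K b E).
Local Notation nbr := (neighbours p q Lam K b E).
Local Notation Kf := (Kfactor p q Lam K b).

(** The maximal function enters only through the closedness of [E] and the bound [cylinder_le]; all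
    constants are explicit. *)
Lemma intrinsic_whitney_decomposition : ~` E !=set0 ->
  exists Z : nat -> spacetime R n,
  let r i := whitney_radius p q Lam K b E (Z i) in
  let l i := l (Z i) in
  let I := nbr Z in
     (forall i, (~` E) (Z i))
  /\ \bigcup_i U 1 (Z i) = ~` E
  /\ (forall i j, i <> j ->
       U (6 * K)^-1 (Z i) `&` U (6 * K)^-1 (Z j) = set0)
  /\ (forall i, 3 * r i <= set_dist (Z i) (U 1 (Z i)) E /\
                set_dist (Z i) (U 1 (Z i)) E <= 4 * r i)
  /\ (forall i, U 4 (Z i) `<=` ~` E /\ U 5 (Z i) `&` E !=set0)
  /\ (forall i j, I i j -> (12 * K)^-1 * r j <= r i /\ r i <= 12 * K * r j)
  /\ (forall i j, I i j ->
       K `^ (- (2 / p)) * l j <= l i /\ l i <= K `^ (2 / p) * l j)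
  /\ (forall i j, I i j -> ~~ isQ (Z i) ->
       2 `^ (- p^-1) * l j <= l i /\ l i <= 2 `^ p^-1 * l j)
  /\ (forall i j, I i j ->
       (lebesgue_st (U 1%R (Z i)) <=
        (mass_ratio (n := n) K)%:E * lebesgue_st (U 1%R (Z j)))%E)
  /\ (forall i j, I i j -> U 2 (Z j) `<=` U (Kf (Z i)) (Z i))
  /\ (forall i, isQ (Z i) ->
       r i `^ alpha * l i `^ q <= K / A * l i `^ p)
  /\ (forall i, ~~ isQ (Z i) -> forall z, Qstd (200 * K * r i) (Z i) z ->
       b (Z i) / 2 <= b z /\ b z <= 2 * b (Z i))
  /\ (forall i, finite_set (I i) /\
       (#|` fset_set (I i)|%fset)%:R <= packing_number (n := n) K)
  /\ exists omega : nat -> spacetime R n -> R,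
     (forall i z, 0 <= omega i z /\ omega i z <= 1)
  /\ (forall i, test_function (U 2 (Z i)) (omega i))
  /\ (forall z, (~` E) z -> series (fun i => omega i z) @ \oo --> (1 : R))
  /\ (forall i j, I i j ->
       ('N[lebesgue_st]_+oo[EFin \o (fun z => enorm (gradient_x (omega j) z))]
          <= (gradient_const (n := n) K * (r i)^-1)%R%:E)%E)
  /\ (forall i j, I i j ->
       ('N[lebesgue_st]_+oo[EFin \o partial_t (omega j)]
          <= (time_const (n := n) K * (r i) ^- 2 *
              (if isQ (Z i) then l i `^ (p - 2) else (l i) ^- 2 * Lam))%R%:E)%E).
Proof.
move=> E_neqT; have K1 := one_le_K; have K0 : 0 < K by lra.
have p0 : 0 < p by have := p2; lra.
have [Z [nEZ cov dis]] := whitney_cover E_neq0 E_closed scale0 K1 scale_comparable E_neqT.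
have UE c i : 0 < c -> U c (Z i) = ball c (Z i) by exact: (Ucyl_ball (@nEZ i)).
have nbrE i : nbr Z i = [set j | ball 2 (Z i) `&` ball 2 (Z j) !=set0].
  by apply/funext => j; rewrite /neighbours /mkset !UE.
have nbrP i j : nbr Z i j -> ball 2 (Z i) `&` ball 2 (Z j) !=set0 by rewrite nbrE.
have nbrC i j : nbr Z i j -> ball 2 (Z j) `&` ball 2 (Z i) !=set0.
  by rewrite nbrE setIC.
have r0 i : 0 < rad (Z i) by exact: (rad0 (@nEZ i)).
exists Z; split; first exact: nEZ.
split; first by rewrite -cov; apply: eq_bigcupr => i _; rewrite UE.
split.
  by move=> i j ij; rewrite !UE ?invr_gt0 ?mulr_gt0//; exact: dis.
split; first by move=> i; exact: set_dist_bounds.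
split.
  move=> i; rewrite !UE//; split; first exact: (wball4_sub E_neq0).
  exact: (wball5_meets E_neq0 E_closed scale0).
have r_cmp i j : ball 2 (Z i) `&` ball 2 (Z j) !=set0 ->
    rad (Z i) <= 12 * K * rad (Z j).
  move=> ij; apply: le_trans (wradius_neighbour E_neq0 scale0 K1 scale_comparable
    (@nEZ i) (@nEZ j) ij) _.
  rewrite -!mulrA; apply: ler_wpM2r; last by rewrite ler_nat.
  by rewrite mulr_ge0 // ltW // r0.
split.
  move=> i j ij; split; last exact/r_cmp/nbrP.
  by rewrite ler_pdivrMl ?mulr_gt0//; exact/r_cmp/nbrC.
split.
  move=> i j ij; split; last by apply: lambda_compare => //; exact: nbrP.
  by apply: inv_powR_le => //; apply: lambda_compare => //; exact: nbrC.
split.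
  move=> i j /nbrP ij Gi.
  have [ijP jiP] := lambda_neighbourG p2 pq b0 b_lt kappa0 K_ge
    (b_close (@nEZ i) (@nEZ j) ij) Gi.
  have two (z w : spacetime R n) : l z `^ p <= 2 * l w `^ p ->
      l z <= 2 `^ p^-1 * l w.
    move=> h; rewrite -[p^-1]mul1r; apply: (lambda_ratio p2 b0 b_lt) => //.
    by rewrite powRr1.
  by split; [apply: inv_powR_le => //|]; exact: two.
split.
  move=> i j /nbrP ij; rewrite !UE//.
  exact: (wball_volume_neighbour E_neq0 E_closed scale0 K1 scale_comparable).
split.
  move=> i j /nbrP ij.
  have K50 : 50 * K <= Kf (Z i).
    rewrite /Kfactor; case: ifP => // _; rewrite ler_pM2l// expr2 ler_peMl//.
    exact: ltW.
  rewrite !UE//; last by apply: lt_le_trans K50; rewrite mulr_gt0.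
  move=> z zj; apply: (wball_sub E_neq0 E_closed scale0 (@nEZ i) K50).
  exact: (wball_neighbour E_neq0 E_closed scale0 K1 scale_comparable (@nEZ i) (@nEZ j) ij).
split; first by move=> i _; exact: radius_power.
split; first by move=> i Gi z; exact: small_cylinder.
split.
  move=> i; rewrite nbrE.
  exact: (finite_meeting E_neq0 E_closed scale0 K1 scale_comparable nEZ dis).
exists (whitney_partition E scale Z).
split; first exact: whitney_partition_bounds.
split.
  by move=> i; rewrite UE//; exact: (whitney_partition_test E_neq0 E_closed scale0 nEZ).
split; first by move=> z; exact: (whitney_partition_sum E_neq0 E_closed scale0 nEZ cov).
have grad i j z : nbr Z i j -> enorm (gradient_x (whitney_partition E scale Z j) z) <=
    gradient_const (n := n) K * (rad (Z i))^-1.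
  move=> /nbrP; exact: (whitney_partition_gradient E_neq0 E_closed scale0 K1
    scale_comparable nEZ dis).
have time i j z : nbr Z i j -> `|partial_t (whitney_partition E scale Z j) z| <=
    time_const (n := n) K * (scale (Z i) / rad (Z i) ^+ 2).
  move=> /nbrP; exact: (whitney_partition_time E_neq0 E_closed scale0 K1
    scale_comparable nEZ dis).
split => i j ij.
  apply: Linfty_le => [|z]; first exact: le_trans (enorm_ge0 _) (grad i j 0 ij).
  by rewrite ger0_norm ?enorm_ge0//; exact: grad.
have -> : time_const (n := n) K * rad (Z i) ^- 2 *
    (if isQ (Z i) then l (Z i) `^ (p - 2) else l (Z i) ^- 2 * Lam) =
    time_const (n := n) K * (scale (Z i) / rad (Z i) ^+ 2).
  rewrite -mulrA [rad (Z i) ^- 2 * _]mulrC /intrinsic_scale.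
  by case: ifP => // _; rewrite [Lam * _]mulrC.
by apply: Linfty_le => [|z]; [exact: le_trans (normr_ge0 _) (time i j 0 ij)|exact: time].
Qed.

End intrinsic_whitney.

Theorem proposition3p2 (R : realType) :
  exists (c_vii c_xi c_xiii c_xiv : nat -> R -> R) (c_ix : R -> R -> R -> R),
  forall (n : nat) (p q alpha : R) (Omega : set 'rV[R]_n) (T : R)
    (a : spacetime R n -> R) (A : R) (f : spacetime R n -> R)
    (c0 Lam0 Lam : R),
  (1 <= n)%N -> 2 <= p -> p < q -> 0 < alpha -> alpha <= 1 ->
  q <= p + 2 * alpha / (n%:R + 2) ->
  open Omega -> bounded_set Omega -> 0 < T ->
  let OmegaT := space_time_cylinder Omega T in
  (forall z, OmegaT z -> 0 <= a z) ->
  (exists m, forall z, OmegaT z -> a z <= m) ->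
  0 < A ->
  (forall x y t, OmegaT (x, t) -> OmegaT (y, t) ->
     `|a (x, t) - a (y, t)| <= A * enorm (x - y) `^ alpha) ->
  (forall x t s, OmegaT (x, t) -> OmegaT (x, s) ->
     `|a (x, t) - a (x, s)| <= A * `|t - s| `^ (alpha / 2)) ->
  let b := holder_extension Omega T alpha A a in
  (forall z, 0 <= f z) ->
  f \in Lfun lebesgue_st p%:E ->
  let energy :=
    (\int[lebesgue_st]_z (f z `^ p + b z * f z `^ q)%:E)%E in
  (energy < +oo)%E ->
  let d := (q - 1 + p) / 2 in
  let M := strong_maximal
    (fun z => f z `^ d + (b z * f z `^ q) `^ (d / p)) in
  let maximal_energy := (\int[lebesgue_st]_z M z `^ (p / d))%E in
  (maximal_energy <= c0%:E * energy)%E ->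
  1 + Linfty_norm OmegaT a < Lam0 ->
  (c0%:E * energy <= Lam0%:E)%E ->
  Lam0 < Lam ->
  let E := [set z | (M z <= (Lam `^ (d / p))%R%:E)%E] in
  ~` E !=set0 ->
  let K := Num.sqrt 2 + 800 * A *
    ((unit_ball_volume (R := R) (n := n))^-1 * fine maximal_energy)
      `^ (alpha / (n%:R + 2)) in
  let lam := lambda p q Lam b in
  let isQ := p_phase p q Lam K b in
  let set_dist := intrinsic_set_dist p q Lam K b in
  let U := Ucyl p q Lam K b E in
  let nbr := neighbours p q Lam K b E in
  let Kf := Kfactor p q Lam K b in
  exists Z : nat -> spacetime R n,
  let r i := whitney_radius p q Lam K b E (Z i) in
  let l i := lam (Z i) in
  let I := nbr Z in
     (forall i, (~` E) (Z i))
  /\ (* (i) *)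
     \bigcup_i U 1 (Z i) = ~` E
  /\ (* (ii) *)
     (forall i j, i <> j ->
       U (6 * K)^-1 (Z i) `&` U (6 * K)^-1 (Z j) = set0)
  /\ (* (iii) *)
     (forall i, 3 * r i <= set_dist (Z i) (U 1 (Z i)) E /\
                set_dist (Z i) (U 1 (Z i)) E <= 4 * r i)
  /\ (* (iv) *)
     (forall i, U 4 (Z i) `<=` ~` E /\ U 5 (Z i) `&` E !=set0)
  /\ (* (v) *)
     (forall i j, I i j -> (12 * K)^-1 * r j <= r i /\ r i <= 12 * K * r j)
  /\ (* (vi) *)
     (forall i j, I i j ->
       K `^ (- (2 / p)) * l j <= l i /\ l i <= K `^ (2 / p) * l j)
  /\ (forall i j, I i j -> ~~ isQ (Z i) ->
       2 `^ (- p^-1) * l j <= l i /\ l i <= 2 `^ p^-1 * l j)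
  /\ (* (vii) *)
     (forall i j, I i j ->
       (lebesgue_st (U 1%R (Z i)) <=
        (c_vii n K)%:E * lebesgue_st (U 1%R (Z j)))%E)
  /\ (* (viii) *)
     (forall i j, I i j -> U 2 (Z j) `<=` U (Kf (Z i)) (Z i))
  /\ (* (ix) *)
     (forall i, isQ (Z i) ->
       r i `^ alpha * l i `^ q <= c_ix A alpha K * l i `^ p)
  /\ (* (x) *)
     (forall i, ~~ isQ (Z i) -> forall z, Qstd (200 * K * r i) (Z i) z ->
       b (Z i) / 2 <= b z /\ b z <= 2 * b (Z i))
  /\ (* (xi) *)
     (forall i, finite_set (I i) /\
       (#|` fset_set (I i)|%fset)%:R <= c_xi n K)
  /\ exists omega : nat -> spacetime R n -> R,
     (* (xii) *)
     (forall i z, 0 <= omega i z /\ omega i z <= 1)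
  /\ (forall i, test_function (U 2 (Z i)) (omega i))
  /\ (forall z, (~` E) z -> series (fun i => omega i z) @ \oo --> (1 : R))
  /\ (* (xiii) *)
     (forall i j, I i j ->
       ('N[lebesgue_st]_+oo[EFin \o (fun z => enorm (gradient_x (omega j) z))]
          <= (c_xiii n K * (r i)^-1)%R%:E)%E)
  /\ (* (xiv) *)
     (forall i j, I i j ->
       ('N[lebesgue_st]_+oo[EFin \o partial_t (omega j)]
          <= (c_xiv n K * (r i) ^- 2 *
              (if isQ (Z i) then l i `^ (p - 2) else (l i) ^- 2 * Lam))%R%:E)%E).
Proof.
(* Closed expressions in the permitted arguments, hence available before the exponents, the
   coefficient and [f] are introduced. *)
exists (fun n K => @mass_ratio R n K), (fun n K => @packing_number R n K),
  (fun n K => @gradient_const R n K), (fun n K => @time_const R n K),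
  (fun A _ K => K / A).
move=> n p q alpha Omega T a A f c0 Lam0 Lam n1 p2 pq al0 al1 q_le oOm bOm T0 OmegaT.
move=> a0 a_bnd A0 aHx aHt b f0 fLp energy energy_fin d M me me_le Lam0a Lam0e Lam0L.
move=> E E_neqT K lam isQ set_dist U nbr Kf.
have d0 : 0 < d by rewrite /d; lra.
have p0 : 0 < p by lra.
have Linf0 := Linfty_norm_ge0 Omega T a.
have Lam_gt0 : 0 < Lam by move: Linf0 Lam0a; rewrite -/OmegaT; lra.
have b_lt z : 1 + b z < Lam.
  by have := holder_extension_le Omega T alpha A a z; move: Lam0a; rewrite -/OmegaT -/b; lra.
have me_ge0 : (0 <= me)%E by apply: integral_ge0 => z _; exact: poweR_ge0.
(* Finiteness ensures that [fine] in the definition of [K] returns the actual energy. *)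
have me_fin : me \is a fin_num.
  rewrite ge0_fin_numE//; apply: le_lt_trans me_le _; apply: le_lt_trans Lam0e _.
  exact: ltry.
have E_cyl z : ~ E z -> exists w r s, [/\ 0 < r, 0 < s, cylinder w r s z &
    cylinder w r s `<=` ~` E].
  by move=> /strong_maximal_superlevel[w [r [s [r0 s0 zw sub]]]]; exists w, r, s.
have E_closed z : ~ E z -> exists2 rho, 0 < rho &
    forall w, enorm (w.1 - z.1) < rho -> `|w.2 - z.2| < rho -> ~ E w.
  move=> /E_cyl[w [r [s [r0 s0 /cylinder_inner[rho rho0 near] sub]]]].
  by exists rho => // w' wx wt; exact/sub/near.
have cyl_le z r s : 0 < r -> 0 < s -> cylinder z r s `<=` ~` E ->
    Lam * (unit_ball_volume (R := R) (n := n) * r ^+ n * (2 * s)) <= fine me.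
  move=> r0 s0 sub; rewrite -lee_fin fineK// EFinM -(cylinder_volume z)//.
  apply: superlevel_le_integral; [exact: ltW|exact: measurable_cylinder| |].
    by move=> w; exact: poweR_ge0.
  move=> w /sub; rewrite /E/= => /negP; rewrite -ltNge => /ltW Mw.
  (* The level of [E] is the power d / p of [Lam] and the energy integrates the power p / d, so the
     integrand is at least [Lam] off [E]. *)
  have -> : Lam%:E = ((Lam `^ (d / p))%:E `^ (p / d))%E.
    rewrite poweR_EFin -powRrM mulrA divfK ?gt_eqF// divff ?gt_eqF//.
    by rewrite powRr1// ltW.
  apply: gt0_ler_poweR => //; rewrite ?in_itv/= ?leey ?andbT ?lee_fin ?powR_ge0//.
    by rewrite divr_ge0 ?ltW.
  by apply: le_trans Mw; rewrite lee_fin powR_ge0.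
apply: (intrinsic_whitney_decomposition p2 pq al0 al1 q_le A0 _ b_lt _ E_closed cyl_le) => //.
- by move=> z; exact: holder_extension_ge0.
- by move=> z w; exact: holder_extension_holder.
Qed.
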